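(* Let $\mathcal A$ be an exact category satisfying (AIC), $G$ an abelian group, $\chi:\mathrm{Ob}\,\mathcal A\to G$ a dimensional theory on $\mathcal A$, and $X\in\underleftrightarrow{\lim}\,\mathcal A$. Then $\mathrm{Dim}_\chi(X)$ is a $G$-torsor.
   Context: Exact categories are in the sense of Quillen, with admissible short exact sequences $a'\hookrightarrow a\twoheadrightarrow a''$, admissible monomorphisms $\hookrightarrow$ and admissible epimorphisms $\twoheadrightarrow$. (AIC): any pair of admissible monomorphisms with the same target $a'\hookrightarrow a\hookleftarrow a''$ has a pullback in $\mathcal A$, and all morphisms of the resulting square are admissible monomorphisms. $\mathrm{Pro}^a(\mathcal A)$ (resp. $\mathrm{Ind}^a(\mathcal A)$) is the full subcategory of $\mathrm{Pro}(\mathcal A)$ (resp. $\mathrm{Ind}(\mathcal A)$) of formal limits (resp. colimits) of countable systems whose structure morphisms are admissible epimorphisms (resp. monomorphisms); admissible short exact sequences are those isomorphic to the formal limit (resp. colimit) of a system of admissible short exact sequences of $\mathcal A$. The Beilinson category $\underleftrightarrow{\lim}\,\mathcal A$ is the full subcategory of $\mathrm{Ind}^a\mathrm{Pro}^a(\mathcal A)$ of objects $``\varinjlim_j''\,``\varprojlim_i''\,X_{i,j}$, $(i,j)\in\mathbb Z\times\mathbb Z$, $i\le j$, with admissible monomorphisms $X_{i,j}\hookrightarrow X_{i,j'}$ and admissible epimorphisms $X_{i,j}\twoheadrightarrow X_{i',j}$ ($i\le i'\le j\le j'$; formal limit over $i\to-\infty$, formal colimit over $j\to+\infty$), all the resulting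 squares being cartesian (hence cocartesian). Its admissible short exact sequences are those of $\mathrm{Ind}^a(\mathrm{Pro}^a(\mathcal A))$ with terms in $\underleftrightarrow{\lim}\,\mathcal A$. The Sato Grassmannian $\Gamma(X)$ is the set of admissible subobjects $[V\hookrightarrow X]$ (admissible monomorphisms up to isomorphism over $X$) with $V\in\mathrm{Pro}^a(\mathcal A)$, $X/V\in\mathrm{Ind}^a(\mathcal A)$; for $U\hookrightarrow V$ in $\Gamma(X)$, $V/U\in\mathcal A$. A dimensional theory is a function $\chi:\mathrm{Ob}\,\mathcal A\to G$ with $\chi(a)=\chi(a')+\chi(a'')$ for every admissible short exact sequence $a'\hookrightarrow a\twoheadrightarrow a''$. $\mathrm{Dim}_\chi(X)$ is the set of $\chi$-relative dimensional theories on $X$, i.e. maps $d:\Gamma(X)\to G$ such that $d(V)=d(U)+\chi(V/U)$ for all admissible monomorphisms $U\hookrightarrow V$ between elements $U,V\in\Gamma(X)$. $G$ acts on it by $(g*d)(U)=g+d(U)$. A $G$-torsor is a set with a free and transitive action of $G$. *)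

(* Defs.v *)
From HB Require Import structures.
From mathcomp Require Import all_boot all_order all_algebra.
From Stdlib Require Import Setoid Morphisms.

Set Implicit Arguments.
Unset Strict Implicit.
Unset Printing Implicit Defensive.

Import Order.TTheory GRing.Theory Num.Theory.

Declare Scope cat_scope.
Delimit Scope cat_scope with cat.
Local Open Scope cat_scope.

(* Hom-sets are setoids: two morphisms are the same when they are related by
   [heq].  An ordinary category is the case where [heq] is [eq]; the extra
   generality replaces the quotients in the Hom-sets of Pro and Ind. *)
#[projections(primitive)]
Record category := Category {
  ob :> Type;
  hom : ob -> ob -> Type;
  heq : forall a b, hom a b -> hom a b -> Prop;
  idm : forall a, hom a a;
  comp : forall a b c, hom b c -> hom a b -> hom a c;
  heq_equiv : forall a b, Equivalence (@heq a b);
  comp_heq : forall a b c (g g' : hom b c) (f f' : hom a b),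
    heq g g' -> heq f f' -> heq (comp g f) (comp g' f');
  comp_assoc : forall a b c d (h : hom c d) (g : hom b c) (f : hom a b),
    heq (comp h (comp g f)) (comp (comp h g) f);
  comp_idl : forall a b (f : hom a b), heq (comp (idm b) f) f;
  comp_idr : forall a b (f : hom a b), heq (comp f (idm a)) f }.

Arguments hom {c} : rename.
Arguments heq {c a b} : rename.
Arguments idm {c} : rename.
Arguments comp {c a b c0} : rename.

Notation "f ≈ g" := (heq f g) (at level 70, no associativity) : cat_scope.
Notation "g ∘ f" := (comp g f) (at level 40, left associativity) : cat_scope.

#[export] Instance heq_Equivalence (C : category) (a b : C) :
  Equivalence (@heq C a b) := heq_equiv a b.

#[export] Instance comp_Proper (C : category) (a b c : C) :
  Proper (heq ==> heq ==> heq) (@comp C a b c).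
Proof. by move=> g g' eg f f' ef; apply: comp_heq. Qed.

Program Definition op (C : category) : category :=
  {| ob := ob C; hom := fun a b => @hom C b a;
     heq := fun a b f g => f ≈ g;
     idm := fun a => idm a;
     comp := fun a b c g f => f ∘ g |}.
Next Obligation. by apply: comp_heq. Qed.
Next Obligation. by symmetry; apply: comp_assoc. Qed.
Next Obligation. by apply: comp_idr. Qed.
Next Obligation. by apply: comp_idl. Qed.

Program Definition full_subcategory (C : category) (P : C -> Prop) : category :=
  {| ob := {x : C | P x}; hom := fun a b => hom (sval a) (sval b);
     heq := fun a b f g => f ≈ g;
     idm := fun a => idm (sval a);
     comp := fun a b c g f => g ∘ f |}.
Next Obligation. by apply: comp_heq. Qed.
Next Obligation. by apply: comp_assoc. Qed.
Next Obligation. by apply: comp_idl. Qed.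
Next Obligation. by apply: comp_idr. Qed.

Definition inverse_pair (C : category) (a b : C) (f : hom a b) (g : hom b a) :=
  g ∘ f ≈ idm a /\ f ∘ g ≈ idm b.

Definition is_iso (C : category) (a b : C) (f : hom a b) :=
  exists g : hom b a, inverse_pair f g.

Definition isomorphic (C : category) (a b : C) := exists f : hom a b, is_iso f.

Definition iso_seq (C : category) (a b c : C) (f : hom a b) (g : hom b c)
    (a' b' c' : C) (f' : hom a' b') (g' : hom b' c') :=
  exists (u : hom a a') (v : hom b b') (w : hom c c'),
    [/\ is_iso u, is_iso v, is_iso w, v ∘ f ≈ f' ∘ u & w ∘ g ≈ g' ∘ v].

Definition is_pullback (C : category) (a b c p : C)
    (f : hom a c) (g : hom b c) (f' : hom p a) (g' : hom p b) :=
  f ∘ f' ≈ g ∘ g' /\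
  forall t (u : hom t a) (v : hom t b), f ∘ u ≈ g ∘ v ->
    exists w : hom t p, [/\ f' ∘ w ≈ u, g' ∘ w ≈ v &
      forall w', f' ∘ w' ≈ u -> g' ∘ w' ≈ v -> w' ≈ w].

Definition is_pushout (C : category) (a b c p : C)
    (f : hom c a) (g : hom c b) (f' : hom a p) (g' : hom b p) :=
  @is_pullback (op C) a b c p f g f' g'.

Definition is_zero_object (C : category) (z : C) := forall a : C,
  (exists f : hom a z, forall g : hom a z, g ≈ f) /\
  (exists f : hom z a, forall g : hom z a, g ≈ f).

Record preadditive (C : category) := Preadditive {
  hzero : forall a b : C, hom a b;
  hadd : forall a b : C, hom a b -> hom a b -> hom a b;
  hopp : forall a b : C, hom a b -> hom a b;
  hadd_heq : forall a b (f f' g g' : hom a b),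
    f ≈ f' -> g ≈ g' -> hadd f g ≈ hadd f' g';
  hopp_heq : forall a b (f f' : hom a b), f ≈ f' -> hopp f ≈ hopp f';
  haddA : forall a b (f g h : hom a b), hadd f (hadd g h) ≈ hadd (hadd f g) h;
  haddC : forall a b (f g : hom a b), hadd f g ≈ hadd g f;
  hadd0 : forall a b (f : hom a b), hadd (hzero a b) f ≈ f;
  haddN : forall a b (f : hom a b), hadd (hopp f) f ≈ hzero a b;
  comp_haddl : forall a b c (g h : hom b c) (f : hom a b),
    hadd g h ∘ f ≈ hadd (g ∘ f) (h ∘ f);
  comp_haddr : forall a b c (g : hom b c) (f h : hom a b),
    g ∘ hadd f h ≈ hadd (g ∘ f) (g ∘ h) }.

Section Preadditive.
Variables (C : category) (M : preadditive C).

Definition is_biproduct (a b s : C)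
    (i1 : hom a s) (i2 : hom b s) (p1 : hom s a) (p2 : hom s b) :=
  [/\ p1 ∘ i1 ≈ idm a, p2 ∘ i2 ≈ idm b, p1 ∘ i2 ≈ hzero M b a,
      p2 ∘ i1 ≈ hzero M a b & hadd M (i1 ∘ p1) (i2 ∘ p2) ≈ idm s].

Definition is_kernel (a b c : C) (p : hom b c) (i : hom a b) :=
  p ∘ i ≈ hzero M a c /\
  forall t (f : hom t b), p ∘ f ≈ hzero M t c ->
    exists2 u : hom t a, i ∘ u ≈ f & forall u', i ∘ u' ≈ f -> u' ≈ u.

Definition is_cokernel (a b c : C) (i : hom a b) (p : hom b c) :=
  p ∘ i ≈ hzero M a c /\
  forall t (f : hom b t), f ∘ i ≈ hzero M a t ->
    exists2 u : hom c t, u ∘ p ≈ f & forall u', u' ∘ p ≈ f -> u' ≈ u.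

End Preadditive.

Record additive (C : category) := Additive {
  additive_pre :> preadditive C;
  has_zero_object : exists z : C, is_zero_object z;
  has_biproducts : forall a b : C, exists (s : C)
    (i1 : hom a s) (i2 : hom b s) (p1 : hom s a) (p2 : hom s b),
    is_biproduct additive_pre i1 i2 p1 p2 }.

Record conflation_category := ConflationCategory {
  cat_of :> category;
  conflation : forall a b c : cat_of, hom a b -> hom b c -> Prop }.

Arguments conflation {c a b c0} : rename.

Section Admissible.
Variable E : conflation_category.

Definition adm_mono (a b : E) (m : hom a b) :=
  exists (c : E) (p : hom b c), conflation m p.

Definition adm_epi (b c : E) (p : hom b c) :=
  exists (a : E) (m : hom a b), conflation m p.

End Admissible.

Definition conflation_op (E : conflation_category) : conflation_category :=
  {| cat_of := op E;
     conflation := fun a b c (f : @hom (op E) a b) (g : @hom (op E) b c) =>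
       @conflation E c b a g f |}.

(* Quillen's original axioms; the last two are known to be redundant. *)
Record exact_structure (E : conflation_category) := ExactStructure {
  exact_additive : additive E;
  conflation_iso : forall (a b c a' b' c' : E) (f : hom a b) (g : hom b c)
    (f' : hom a' b') (g' : hom b' c'),
    iso_seq f g f' g' -> conflation f g -> conflation f' g';
  conflation_split : forall (a b s : E) (i1 : hom a s) (i2 : hom b s)
    (p1 : hom s a) (p2 : hom s b),
    is_biproduct exact_additive i1 i2 p1 p2 -> conflation i1 p2;
  conflation_kernel : forall (a b c : E) (m : hom a b) (p : hom b c),
    conflation m p -> is_kernel exact_additive p m;
  conflation_cokernel : forall (a b c : E) (m : hom a b) (p : hom b c),
    conflation m p -> is_cokernel exact_additive m p;
  adm_epi_comp : forall (a b c : E) (p : hom a b) (q : hom b c),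
    adm_epi p -> adm_epi q -> adm_epi (q ∘ p);
  adm_mono_comp : forall (a b c : E) (m : hom a b) (n : hom b c),
    adm_mono m -> adm_mono n -> adm_mono (n ∘ m);
  adm_epi_pullback : forall (a b c : E) (p : hom a c) (f : hom b c),
    adm_epi p -> exists (d : E) (f' : hom d a) (p' : hom d b),
      is_pullback p f f' p' /\ adm_epi p';
  adm_mono_pushout : forall (a b c : E) (m : hom c a) (f : hom c b),
    adm_mono m -> exists (d : E) (f' : hom a d) (m' : hom b d),
      is_pushout m f f' m' /\ adm_mono m';
  adm_epi_obscure : forall (k a b c : E) (i : hom k b) (f : hom b c) (g : hom a b),
    is_kernel exact_additive f i -> adm_epi (f ∘ g) -> adm_epi f;
  adm_mono_obscure : forall (k a b c : E) (i : hom b k) (f : hom c b) (g : hom b a),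
    is_cokernel exact_additive f i -> adm_mono (g ∘ f) -> adm_mono f }.

Record exact_category := ExactCategory {
  exact_cat :> conflation_category;
  exact_axioms : exact_structure exact_cat }.

Definition AIC (A : conflation_category) :=
  forall (a a' a'' : A) (m : hom a' a) (n : hom a'' a),
    adm_mono m -> adm_mono n ->
    exists (p : A) (m' : hom p a') (n' : hom p a''),
      [/\ is_pullback m n m' n', adm_mono m' & adm_mono n'].

Record directed_set := DirectedSet {
  carrier :> countType;
  dle : carrier -> carrier -> Prop;
  dle_refl : forall i, dle i i;
  dle_trans : forall i j k, dle i j -> dle j k -> dle i k;
  dle_directed : forall i j, exists k, dle i k /\ dle j k;
  dle_inhabited : exists _ : carrier, True }.

Record system (I : directed_set) (C : category) := System {
  sob :> I -> C;
  smap : forall i j, dle i j -> hom (sob j) (sob i);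
  smap_id : forall i (l : dle i i), smap l ≈ idm (sob i);
  smap_comp : forall i j k (l : dle i j) (l' : dle j k) (l'' : dle i k),
    smap l ∘ smap l' ≈ smap l'' }.

#[projections(primitive)]
Record proob (C : category) := Proob { pidx : directed_set; psys :> system pidx C }.

Section Germs.
Variable C : category.

(* Representatives of the elements of colim_i Hom(X_i, c), and equality of the
   elements they represent. *)
Definition germ (X : proob C) (c : C) := {i : pidx X & hom (X i) c}.

Definition germ_eq (X : proob C) (c : C) (f g : germ X c) :=
  exists (k : pidx X) (l : dle (projT1 f) k) (l' : dle (projT1 g) k),
    projT2 f ∘ smap X l ≈ projT2 g ∘ smap X l'.

Definition germ_post (X : proob C) (c c' : C) (u : hom c c') (f : germ X c) :
  germ X c' := existT _ (projT1 f) (u ∘ projT2 f).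

(* Hom(X, Y) = lim_j colim_i Hom(X_i, Y_j). *)
Record prohom (X Y : proob C) := Prohom {
  germ_at :> forall j : pidx Y, germ X (Y j);
  germ_compat : forall j j' (l : dle j j'),
    germ_eq (germ_at j) (germ_post (smap Y l) (germ_at j')) }.

Definition prohom_eq (X Y : proob C) (f g : prohom X Y) :=
  forall j, germ_eq (f j) (g j).

Lemma germ_eq_equiv (X : proob C) (c : C) : Equivalence (@germ_eq X c).
Proof.
split.
- by move=> [i f]; exists i, (dle_refl i), (dle_refl i); reflexivity.
- by move=> f g [k [l [l' e]]]; exists k, l', l; symmetry.
move=> [i f] [j g] [k h] [a [p [q e]]] [b [r [s e']]] /=.
have [d [ad bd]] := dle_directed a b.
exists d, (dle_trans p ad), (dle_trans s bd) => /=.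
rewrite -(smap_comp X p ad) -(smap_comp X s bd) !comp_assoc e -e'.
by rewrite -!comp_assoc !(smap_comp X _ _ (dle_trans q ad)); reflexivity.
Qed.
#[local] Existing Instance germ_eq_equiv.

Lemma germ_post_eq (X : proob C) (c c' : C) (u u' : hom c c') (f f' : germ X c) :
  u ≈ u' -> germ_eq f f' -> germ_eq (germ_post u f) (germ_post u' f').
Proof.
move=> eu [k [l [l' e]]]; exists k, l, l' => /=.
by rewrite -!comp_assoc e eu; reflexivity.
Qed.

Lemma germ_post_comp (X : proob C) (a b c : C) (u : hom b c) (v : hom a b)
  (f : germ X a) : germ_eq (germ_post u (germ_post v f)) (germ_post (u ∘ v) f).
Proof.
exists (projT1 f), (dle_refl _), (dle_refl _) => /=.
by rewrite comp_assoc; reflexivity.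
Qed.

Definition germ_pre (X Y : proob C) (c : C) (g : germ Y c) (f : prohom X Y) :
  germ X c := germ_post (projT2 g) (f (projT1 g)).

Lemma germ_pre_eq (X Y : proob C) (c : C) (g g' : germ Y c) (f f' : prohom X Y) :
  germ_eq g g' -> prohom_eq f f' -> germ_eq (germ_pre g f) (germ_pre g' f').
Proof.
move=> [k [l [l' e]]] ef; rewrite /germ_pre.
transitivity (germ_post (projT2 g ∘ smap Y l) (f k)).
  transitivity (germ_post (projT2 g) (germ_post (smap Y l) (f k))).
    by apply: germ_post_eq; [reflexivity|exact: germ_compat].
  exact: germ_post_comp.
transitivity (germ_post (projT2 g' ∘ smap Y l') (f' k)).
  exact: germ_post_eq.
transitivity (germ_post (projT2 g') (germ_post (smap Y l') (f' k))).
  by symmetry; apply: germ_post_comp.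
by apply: germ_post_eq; [reflexivity|symmetry; exact: germ_compat].
Qed.

Program Definition prohom_comp (X Y Z : proob C) (g : prohom Y Z)
    (f : prohom X Y) : prohom X Z :=
  {| germ_at := fun k => germ_pre (g k) f |}.
Next Obligation.
transitivity (germ_pre (germ_post (smap Z l) (g j')) f).
  by apply: germ_pre_eq; [exact: germ_compat|move=> ?; reflexivity].
by symmetry; apply: germ_post_comp.
Qed.

End Germs.
#[export] Existing Instance germ_eq_equiv.

(* A morphism of systems over a fixed index set, and its formal limit. *)
Record system_hom (I : directed_set) (C : category) (S T : system I C) :=
  SystemHom {
    shom :> forall i, hom (S i) (T i);
    shom_nat : forall i j (l : dle i j), shom i ∘ smap S l ≈ smap T l ∘ shom j }.

Program Definition formal_lim (I : directed_set) (C : category)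
    (S T : system I C) (f : system_hom S T) : prohom (Proob S) (Proob T) :=
  {| germ_at := fun i => existT _ i (f i) |}.
Next Obligation.
exists j', l, (dle_refl j') => /=.
by rewrite shom_nat smap_id comp_idr; reflexivity.
Qed.

Program Definition system_id (I : directed_set) (C : category)
    (S : system I C) : system_hom S S := {| shom := fun i => idm (S i) |}.
Next Obligation. by rewrite comp_idl comp_idr; reflexivity. Qed.

Program Definition pro (C : category) : category :=
  {| ob := proob C; hom := @prohom C; heq := @prohom_eq C;
     idm := fun X => formal_lim (system_id X);
     comp := @prohom_comp C |}.
Next Obligation.
split.
- by move=> f i; reflexivity.
- by move=> f g e i; symmetry; exact: e.
- by move=> f g h e e' i; transitivity (g i); [exact: e|exact: e'].
Qed.
Next Obligation. by move=> i; apply: germ_pre_eq; [exact: H|exact: H0]. Qed.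
Next Obligation. by move=> i; apply: germ_post_comp. Qed.
Next Obligation.
move=> i; exists (projT1 (f i)), (dle_refl _), (dle_refl _) => /=.
by rewrite comp_idl; reflexivity.
Qed.
Next Obligation.
move=> i; exists (projT1 (f i)), (dle_refl _), (dle_refl _) => /=.
by rewrite comp_idr; reflexivity.
Qed.

Section ProA.
Variable E : conflation_category.

Definition admissible_system (I : directed_set) (S : system I E) :=
  forall i j (l : dle i j), adm_epi (smap S l).

Definition proa_category :=
  @full_subcategory (pro E) (fun X : proob E => admissible_system X).

Definition mk_proa (I : directed_set) (S : system I E)
  (hS : admissible_system S) : proa_category := exist _ (Proob S) hS.

Definition proa_conflation (X Y Z : proa_category)
    (f : hom X Y) (g : hom Y Z) : Prop :=
  exists (I : directed_set) (S T U : system I E)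
    (hS : admissible_system S) (hT : admissible_system T)
    (hU : admissible_system U) (m : system_hom S T) (p : system_hom T U),
    (forall i, conflation (m i) (p i)) /\
    @iso_seq proa_category (mk_proa hS) (mk_proa hT) (mk_proa hU)
      (formal_lim m) (formal_lim p) X Y Z f g.

Definition proa : conflation_category :=
  {| cat_of := proa_category; conflation := proa_conflation |}.

End ProA.

(* Ind(C) = Pro(C^op)^op, and admissible epimorphisms of the opposite category
   are admissible monomorphisms. *)
Definition inda (E : conflation_category) : conflation_category :=
  conflation_op (proa (conflation_op E)).

Lemma comp_zero_l (C : category) (M : preadditive C) (a b c : C) (f : hom a b) :
  hzero M b c ∘ f ≈ hzero M a c.
Proof.
set x := _ ∘ f.
have xx : hadd M x x ≈ x.
  by rewrite /x -comp_haddl; apply: comp_heq; [exact: hadd0|reflexivity].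
have e : hadd M (hopp M x) (hadd M x x) ≈ hzero M a c.
  by transitivity (hadd M (hopp M x) x);
    [apply: hadd_heq; [reflexivity|exact: xx]|exact: haddN].
rewrite -e haddA; symmetry; transitivity (hadd M (hzero M a c) x).
  by apply: hadd_heq; [exact: haddN|reflexivity].
exact: hadd0.
Qed.

Lemma zero_to_eq (C : category) (z : C) : is_zero_object z ->
  forall a (f g : hom a z), f ≈ g.
Proof. by move=> hz a f g; have [[h e] _] := hz a; rewrite (e f) (e g); reflexivity. Qed.

Lemma zero_from_eq (C : category) (z : C) : is_zero_object z ->
  forall a (f g : hom z a), f ≈ g.
Proof. by move=> hz a f g; have [_ [h e]] := hz a; rewrite (e f) (e g); reflexivity. Qed.

Lemma iso_idm (C : category) (a : C) : is_iso (idm a).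
Proof. by exists (idm a); split; apply: comp_idl. Qed.

Lemma iso_seq_refl (C : category) (a b c : C) (f : hom a b) (g : hom b c) :
  iso_seq f g f g.
Proof.
exists (idm a), (idm b), (idm c); split; try exact: iso_idm.
- by rewrite comp_idl comp_idr; reflexivity.
- by rewrite comp_idl comp_idr; reflexivity.
Qed.

Section TrivialConflations.
Variable A : exact_category.
Let M := exact_additive (exact_axioms A).

Lemma conflation_zero_id (z a : A) (f : hom z a) :
  is_zero_object z -> conflation f (idm a).
Proof.
move=> hz; have [[g _] _] := hz a.
apply: (@conflation_split _ (exact_axioms A) _ _ _ f (idm a) g (idm a)); split.
- exact: zero_to_eq.
- exact: comp_idl.
- exact: zero_to_eq.
- exact: zero_from_eq.
transitivity (hadd M (hzero M a a) (idm a)); last exact: hadd0.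
apply: hadd_heq; last exact: comp_idl.
rewrite -(comp_zero_l M a g); apply: comp_heq; last reflexivity.
exact: zero_from_eq.
Qed.

Lemma conflation_id_zero (a z : A) (g : hom a z) :
  is_zero_object z -> conflation (idm a) g.
Proof.
move=> hz; have [_ [f _]] := hz a.
apply: (@conflation_split _ (exact_axioms A) _ _ _ (idm a) f (idm a) g); split.
- exact: comp_idl.
- exact: zero_to_eq.
- exact: zero_from_eq.
- exact: zero_to_eq.
transitivity (hadd M (hzero M a a) (idm a)); last exact: hadd0.
transitivity (hadd M (f ∘ g) (idm a ∘ idm a)); first exact: haddC.
apply: hadd_heq; last exact: comp_idl.
rewrite -(comp_zero_l M a g); apply: comp_heq; last reflexivity.
exact: zero_from_eq.
Qed.

Lemma adm_epi_id (a : A) : adm_epi (idm a).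
Proof.
have [z hz] := has_zero_object M; have [_ [f _]] := hz a.
by exists z, f; apply: conflation_zero_id.
Qed.

End TrivialConflations.

Program Definition point : directed_set :=
  {| carrier := unit : countType; dle := fun _ _ => True |}.
Next Obligation. by exists tt. Qed.
Next Obligation. by exists tt. Qed.

Program Definition const_system (I : directed_set) (C : category) (c : C) :
  system I C := {| sob := fun _ => c; smap := fun _ _ _ => idm c |}.
Next Obligation. by reflexivity. Qed.
Next Obligation. by apply: comp_idl. Qed.

Program Definition const_system_hom (I : directed_set) (C : category) (a b : C)
    (f : hom a b) : system_hom (const_system I a) (const_system I b) :=
  {| shom := fun _ => f |}.
Next Obligation. by rewrite comp_idl comp_idr; reflexivity. Qed.

Section Embeddings.
Variable A : exact_category.

Lemma const_admissible (I : directed_set) (a : A) :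
  @admissible_system A I (const_system I a).
Proof. by move=> i j l; apply: adm_epi_id. Qed.

Arguments const_admissible : clear implicits.

Definition const_proa (a : A) : proa A := mk_proa (const_admissible point a).

Definition const_proa_map (a b : A) (f : hom a b) :
    hom (const_proa a) (const_proa b) :=
  formal_lim (const_system_hom point f).

Lemma const_proa_map_mono (a b : A) (f : hom a b) :
  adm_mono f -> adm_mono (const_proa_map f).
Proof.
move=> [c [p fp]]; exists (const_proa c), (const_proa_map p).
exists point, (const_system point a), (const_system point b), (const_system point c).
exists (const_admissible point a), (const_admissible point b),
  (const_admissible point c), (const_system_hom point f), (const_system_hom point p).
by split=> //; apply: iso_seq_refl.
Qed.

Lemma adm_mono_id_proa (X : proa A) : adm_mono (idm X).
Proof.
have [z hz] := has_zero_object (exact_additive (exact_axioms A)).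
case: X => [[I S] hS].
have tz i : {f : @hom A (S i) z | True}.
  by exists (hzero (exact_additive (exact_axioms A)) _ _).
have nz i j (l : dle i j) : sval (tz i) ∘ smap S l ≈ idm z ∘ sval (tz j).
  exact: zero_to_eq.
pose p := @SystemHom I A S (const_system I z) (fun i => sval (tz i)) nz.
exists (mk_proa (const_admissible I z)), (formal_lim p).
exists I, S, S, (const_system I z), hS, hS, (const_admissible I z), (system_id S), p.
split; first by move=> i; apply: conflation_id_zero.
exact: (@iso_seq_refl (proa A)).
Qed.

(* Pro^a(A) -> Ind^a Pro^a(A) *)
Definition inda_of_proa (X : proa A) : inda (proa A) :=
  @mk_proa (conflation_op (proa A)) point (@const_system point (op (proa A)) X)
    (fun _ _ _ => adm_mono_id_proa X).

(* Ind^a(A) -> Ind^a Pro^a(A) *)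
Program Definition const_proa_system (Y : inda A) :
    system (pidx (sval Y)) (op (proa A)) :=
  {| sob := fun j => const_proa (sval Y j);
     smap := fun i j l => const_proa_map (smap (sval Y) l) |}.
Next Obligation.
by move=> k; exists tt, I, I => /=; rewrite (smap_id Y l); reflexivity.
Qed.
Next Obligation.
move=> t; exists tt, I, I => /=; rewrite !comp_idr.
exact: (smap_comp Y l l' l'').
Qed.

Lemma const_proa_system_admissible (Y : inda A) :
  @admissible_system (conflation_op (proa A)) _ (const_proa_system Y).
Proof. by move=> i j l; apply: const_proa_map_mono; apply: (svalP Y). Qed.

Arguments const_proa_system_admissible : clear implicits.

Definition inda_of_inda (Y : inda A) : inda (proa A) :=
  mk_proa (const_proa_system_admissible Y).

(* A -> Ind^a Pro^a(A) *)
Definition inda_of_base (a : A) : inda (proa A) := inda_of_proa (const_proa a).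

End Embeddings.

Arguments const_admissible : clear implicits.

(* The poset of pairs i <= j of integers; (i, j) <= (i', j') when i <= i' and
   j <= j'. *)
Definition zpair := {p : int * int | (p.1 <= p.2)%R}.
Definition lo (p : zpair) : int := (val p).1.
Definition hi (p : zpair) : int := (val p).2.
Definition zpair_le (p q : zpair) : Prop := (lo p <= lo q)%R /\ (hi p <= hi q)%R.

Record double_system (A : conflation_category) := DoubleSystem {
  dob :> zpair -> A;
  dmap : forall p q, zpair_le p q -> hom (dob p) (dob q);
  dmap_id : forall p (l : zpair_le p p), dmap l ≈ idm (dob p);
  dmap_comp : forall p q r (l : zpair_le p q) (l' : zpair_le q r)
    (l'' : zpair_le p r), dmap l' ∘ dmap l ≈ dmap l'';
  dmap_mono : forall p q (l : zpair_le p q), lo p = lo q -> adm_mono (dmap l);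
  dmap_epi : forall p q (l : zpair_le p q), hi p = hi q -> adm_epi (dmap l);
  dmap_cartesian : forall p q r s (pq : zpair_le p q) (pr : zpair_le p r)
    (qs : zpair_le q s) (rs : zpair_le r s),
    lo p = lo q -> lo r = lo s -> hi p = hi r -> hi q = hi s ->
    is_pullback (dmap qs) (dmap rs) (dmap pq) (dmap pr) }.

Lemma zpair_le_refl p : zpair_le p p.
Proof. by split. Qed.

Lemma zpair_le_trans q p r : zpair_le p q -> zpair_le q r -> zpair_le p r.
Proof. by move=> [a b] [c d]; split; [exact: le_trans a c|exact: le_trans b d]. Qed.

Lemma lo_le_hi (p : zpair) : (lo p <= hi p)%R.
Proof. exact: (valP p). Qed.

Definition zdiag (j : int) : zpair := Sub (j, j) (lexx j).

Lemma row_directed (j : int) (p q : {p : zpair | hi p == j}) :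
  exists r : {p : zpair | hi p == j},
    zpair_le (val r) (val p) /\ zpair_le (val r) (val q).
Proof.
have hpq : hi (val p) = hi (val q) by rewrite (eqP (valP p)) (eqP (valP q)).
have [h|h] := leP (lo (val p)) (lo (val q)).
  by exists p; split; [exact: zpair_le_refl|split=> //; rewrite hpq].
by exists q; split; [split; [exact: ltW|rewrite hpq]|exact: zpair_le_refl].
Qed.

(* For fixed j, the indices i <= j, directed towards -oo. *)
Definition row_index (j : int) : directed_set :=
  @DirectedSet {p : zpair | hi p == j} (fun p q => zpair_le (val q) (val p))
    (fun p => zpair_le_refl (val p))
    (fun p q r pq qr => zpair_le_trans qr pq)
    (@row_directed j)
    (ex_intro _ (exist _ (zdiag j) (eqxx j)) Logic.I).

Program Definition int_index : directed_set :=
  {| carrier := int : countType; dle := fun i j : int => (i <= j)%R |}.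
Next Obligation. exact: le_trans H H0. Qed.
Next Obligation. by exists (Order.max i j); rewrite !le_max !lexx orbT. Qed.
Next Obligation. by exists 0%R. Qed.

(* (i, j) |-> (i, j') *)
Lemma raise_subproof (j j' : int) (l : (j <= j')%R) (p : row_index j) :
  (lo (val p) <= j')%R.
Proof.
by apply: le_trans l; have := lo_le_hi (val p); rewrite (eqP (valP p)).
Qed.

Definition raise (j j' : int) (l : (j <= j')%R) (p : row_index j) : row_index j' :=
  Sub (Sub (lo (val p), j') (raise_subproof l p) : zpair) (eqxx j').

(* (i, j') |-> (min i j, j) *)
Lemma lower_subproof (j : int) (p : zpair) : (Order.min (lo p) j <= j)%R.
Proof. by rewrite ge_min lexx orbT. Qed.

Definition lower (j : int) (p : zpair) : row_index j :=
  Sub (Sub (Order.min (lo p) j, j) (lower_subproof j p) : zpair) (eqxx j).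

Lemma lower_le (j j' : int) (l : (j <= j')%R) (p : row_index j') :
  zpair_le (val (lower j (val p))) (val p).
Proof.
split; first by rewrite /lo /= ge_min lexx.
by rewrite /hi /=; move: (eqP (valP p)); rewrite /hi /= => ->.
Qed.

Lemma pullback_conflation (A : exact_category) (a b c d x : A)
    (q : hom b d) (n : hom c d) (m : hom a b) (q' : hom a c) (e : hom d x) :
  is_pullback q n m q' -> adm_epi q -> conflation n e -> conflation m (e ∘ q).
Proof.
set M := exact_additive (exact_axioms A).
move=> [sq pb] hq ne; have [en0 ker_n] := conflation_kernel (exact_axioms A) ne.
have he : adm_epi e by exists c, n.
have [k [i ik]] := adm_epi_comp (exact_axioms A) hq he; have [i0 ker_i] := conflation_kernel (exact_axioms A) ik.
have em0 : e ∘ q ∘ m ≈ hzero M a x.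
  by rewrite -comp_assoc sq comp_assoc en0; apply: comp_zero_l.
have [u iu _] := ker_i _ m em0.
have e0 : e ∘ (q ∘ i) ≈ hzero M k x by rewrite comp_assoc.
have [v nv _] := ker_n _ _ e0.
have [w [mw q'w _]] := pb k i v (symmetry nv).
apply: (conflation_iso (exact_axioms A) (f := i) (g := e ∘ q)) ik.
exists w, (idm b), (idm x); split; try exact: iso_idm.
- exists u; split.
    have [t _ uniq_t] := ker_i _ i i0.
    rewrite (uniq_t (u ∘ w)) ?comp_assoc ?iu ?mw; last reflexivity.
    by symmetry; apply: uniq_t; rewrite comp_idr; reflexivity.
  have [t [_ _ uniq_t]] := pb a m q' sq.
  have mwu : m ∘ (w ∘ u) ≈ m by rewrite comp_assoc mw.
  have q'wu : q' ∘ (w ∘ u) ≈ q'.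
    have enq'0 : e ∘ (n ∘ q') ≈ hzero M a x.
      by rewrite comp_assoc en0; apply: comp_zero_l.
    have [z _ uniq_z] := ker_n _ (n ∘ q') enq'0.
    rewrite (uniq_z (q' ∘ (w ∘ u))).
      by symmetry; apply: uniq_z; reflexivity.
    by rewrite comp_assoc -sq -comp_assoc mwu; reflexivity.
  rewrite (uniq_t (w ∘ u)) //; symmetry; apply: uniq_t; rewrite comp_idr; reflexivity.
- by rewrite comp_idl mw; reflexivity.
- by rewrite comp_idl comp_idr; reflexivity.
Qed.

Section FormalDoubleLimit.
Variables (A : exact_category) (D : double_system A).

Lemma dmap_irr (p q : zpair) (l l' : zpair_le p q) : dmap D l ≈ dmap D l'.
Proof.
by rewrite -(dmap_comp D (zpair_le_refl p) l l') dmap_id comp_idr; reflexivity.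
Qed.

Program Definition row_system (j : int) : system (row_index j) A :=
  {| sob := fun p => D (val p); smap := fun p q l => dmap D l |}.
Next Obligation. exact: dmap_id. Qed.
Next Obligation. exact: dmap_comp. Qed.

Lemma row_admissible (j : int) : admissible_system (row_system j).
Proof.
by move=> p q l; apply: dmap_epi; rewrite (eqP (valP p)) (eqP (valP q)).
Qed.

Arguments row_admissible : clear implicits.

(* "lim_i" X_(i,j) *)
Definition row (j : int) : proa A := mk_proa (row_admissible j).

(* At the index (i, j'), the map from X_(min i j, j). *)
Definition row_map_at (j j' : int) (l : (j <= j')%R) (p : row_index j') :
    germ (Proob (row_system j)) (row_system j' p) :=
  existT _ (lower j (val p)) (dmap D (lower_le l p)).

Lemma row_map_compat (j j' : int) (l : (j <= j')%R) (p q : row_index j')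
    (h : dle p q) :
  germ_eq (row_map_at l p) (germ_post (smap (row_system j') h) (row_map_at l q)).
Proof.
have [k [kp kq]] := dle_directed (lower j (val p)) (lower j (val q)).
exists k, kp, kq => /=.
rewrite (dmap_comp D _ _ (zpair_le_trans kp (lower_le l p))) -comp_assoc.
rewrite (dmap_comp D _ _ (zpair_le_trans kq (lower_le l q))).
by rewrite (dmap_comp D _ _ (zpair_le_trans kp (lower_le l p))); reflexivity.
Qed.

Definition row_map (j j' : int) (l : (j <= j')%R) : hom (row j) (row j') :=
  @Prohom A (Proob (row_system j)) (Proob (row_system j'))
    (row_map_at l) (row_map_compat l).

Program Definition col_system : system int_index (op (proa A)) :=
  {| sob := row; smap := fun j j' l => row_map l |}.
Next Obligation.
move=> p; have [k [kp kq]] := dle_directed (lower i (val p)) p.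
exists k, kp, kq => /=.
rewrite comp_idl (dmap_comp D _ _ (zpair_le_trans kp (lower_le l p))).
exact: dmap_irr.
Qed.
Next Obligation.
move=> p; set q := lower j (val p); set r := lower i (val q).
have [n [nr np]] := dle_directed r (lower i (val p)).
exists n, nr, np => /=.
rewrite (dmap_comp D _ _ (zpair_le_trans (lower_le l q) (lower_le l' p))).
rewrite (dmap_comp D _ _ (zpair_le_trans np (lower_le l'' p))).
by rewrite (dmap_comp D _ _ (zpair_le_trans np (lower_le l'' p))); reflexivity.
Qed.

Program Definition raise_system (j j' : int) (l : (j <= j')%R) :
    system (row_index j) A :=
  {| sob := fun p => D (val (raise l p));
     smap := fun p q h => dmap D (_ : zpair_le (val (raise l q)) (val (raise l p))) |}.
Next Obligation. by split=> //; case: h. Qed.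
Next Obligation. exact: dmap_id. Qed.
Next Obligation. exact: dmap_comp. Qed.

Lemma raise_admissible (j j' : int) (l : (j <= j')%R) :
  admissible_system (raise_system l).
Proof. by move=> p q h; apply: dmap_epi. Qed.

Lemma raise_ge (j j' : int) (l : (j <= j')%R) (p : row_index j) :
  zpair_le (val p) (val (raise l p)).
Proof. by split=> //; rewrite (eqP (valP p)). Qed.

Lemma lower_raise (j j' : int) (l : (j <= j')%R) (q : row_index j') :
  zpair_le (val (raise l (lower j (val q)))) (val q).
Proof.
split; first by rewrite /lo /= /lo /= ge_min lexx.
by rewrite (eqP (valP q)).
Qed.

(* The default tactic destructs indices. *)
#[local] Obligation Tactic := idtac.

Program Definition row_of_raise (j j' : int) (l : (j <= j')%R) :
    prohom (Proob (raise_system l)) (Proob (row_system j')) :=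
  {| germ_at := fun q => existT _ (lower j (val q)) (dmap D (lower_raise l q)) |}.
Next Obligation.
move=> j j' l p q h.
have [k [kp kq]] := dle_directed (lower j (val p)) (lower j (val q)).
exists k, kp, kq => /=.
have kp' : zpair_le (val (raise l k)) (val p).
  apply: zpair_le_trans (lower_raise l p); split=> //; by case: kp.
rewrite (dmap_comp D _ _ kp') (dmap_comp D _ _ (zpair_le_trans (lower_raise l q) h)).
by rewrite (dmap_comp D _ _ kp'); reflexivity.
Qed.

Program Definition raise_of_row (j j' : int) (l : (j <= j')%R) :
    prohom (Proob (row_system j')) (Proob (raise_system l)) :=
  {| germ_at := fun p => existT _ (raise l p) (idm _) |}.
Next Obligation.
move=> j j' l p q h.
have [k [kp kq]] := dle_directed (raise l p) (raise l q).
exists k, kp, kq => /=; rewrite comp_idl comp_idr.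
by rewrite (dmap_comp D _ _ kp); reflexivity.
Qed.

Lemma row_of_raise_iso (j j' : int) (l : (j <= j')%R) :
  @inverse_pair (pro A) _ _ (row_of_raise l) (raise_of_row l).
Proof.
split=> [p|q].
  have [k [kp kq]] := dle_directed (lower j (val (raise l p))) p.
  exists k, kp, kq => /=; rewrite !comp_idl.
  have kp' : zpair_le (val (raise l k)) (val (raise l p)).
    by split=> //; case: kq.
  by rewrite (dmap_comp D _ _ kp'); apply: dmap_irr.
have [k [kp kq]] := dle_directed (raise l (lower j (val q))) q.
exists k, kp, kq => /=; rewrite comp_idr comp_idl.
by rewrite (dmap_comp D _ _ kq); reflexivity.
Qed.

Lemma row_map_mono (j j' : int) (l : (j <= j')%R) : adm_mono (row_map l).
Proof.
pose o : row_index j := exist _ (zdiag j) (eqxx j).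
have [c [e ne]] : adm_mono (dmap D (raise_ge l o)) by apply: dmap_mono.
have r0 (p : row_index j) : zpair_le (val (raise l p)) (val (raise l o)).
  by split=> //; have := lo_le_hi (val p); rewrite (eqP (valP p)).
have p0 (p : row_index j) : zpair_le (val p) (val o).
  by split; [have := lo_le_hi (val p)|]; rewrite (eqP (valP p)).
have mnat (p q : row_index j) (h : dle p q) :
    dmap D (raise_ge l p) ∘ smap (row_system j) h ≈
    smap (raise_system l) h ∘ dmap D (raise_ge l q).
  rewrite /= (dmap_comp D _ _ (zpair_le_trans h (raise_ge l p))).
  by rewrite (dmap_comp D _ _ (zpair_le_trans h (raise_ge l p))); reflexivity.
have enat (p q : row_index j) (h : dle p q) :
    e ∘ dmap D (r0 p) ∘ smap (raise_system l) h ≈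
    smap (const_system (row_index j) c) h ∘ (e ∘ dmap D (r0 q)).
  by rewrite /= -comp_assoc (dmap_comp D _ _ (r0 q)) comp_idl; reflexivity.
pose m := @SystemHom _ A (row_system j) (raise_system l) _ mnat.
pose p := @SystemHom _ A (raise_system l) (const_system _ c) _ enat.
pose U := mk_proa (const_admissible A (row_index j) c).
have [vw wv] := row_of_raise_iso l.
exists U, (@comp (pro A) _ _ _ (formal_lim p) (raise_of_row l)).
exists (row_index j), (row_system j), (raise_system l), (const_system _ c).
exists (row_admissible j), (raise_admissible l), (const_admissible A _ c), m, p.
split.
  move=> q.
  have pb := dmap_cartesian D (raise_ge l q) (p0 q) (r0 q) (raise_ge l o)
    erefl erefl (eqP (valP q)) erefl.
  exact: (pullback_conflation pb (dmap_epi D (r0 q) erefl) ne).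
exists (idm _), (row_of_raise l : @hom (proa A) (mk_proa (raise_admissible l)) (row j')), (idm U); split.
- exact: iso_idm.
- by exists (raise_of_row l).
- exact: iso_idm.
- rewrite comp_idr => q /=.
  exists (lower j (val q)), (dle_refl _), (dle_refl _) => /=.
  rewrite (dmap_comp D _ _ (lower_le l q)); reflexivity.
have e3 : @heq (pro A) _ _ (@comp (pro A) _ _ _ (formal_lim p)
    (raise_of_row l) ∘ row_of_raise l) (formal_lim p).
  rewrite -(@comp_assoc (pro A)) vw; exact: (@comp_idr (pro A)).
by rewrite comp_idl; symmetry.
Qed.

Lemma col_admissible : @admissible_system (conflation_op (proa A)) _ col_system.
Proof. by move=> j j' l; apply: row_map_mono. Qed.

(* "colim_j" "lim_i" X_(i,j) *)
Definition double_limit : inda (proa A) := mk_proa col_admissible.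

End FormalDoubleLimit.

(* As usual for full subcategories described by a form of their objects, objects
   isomorphic to a double limit are included. *)
Definition is_beilinson (A : exact_category) (X : inda (proa A)) :=
  exists D : double_system A, isomorphic X (double_limit D).

Definition beilinson (A : exact_category) : conflation_category :=
  {| cat_of := full_subcategory (@is_beilinson A);
     conflation := fun X Y Z f g =>
       @conflation (inda (proa A)) (sval X) (sval Y) (sval Z) f g |}.

Section Grassmannian.
Variable A : exact_category.

Definition in_proa (X : beilinson A) :=
  exists Y : proa A, isomorphic (sval X) (inda_of_proa Y).

Definition in_inda (X : beilinson A) :=
  exists Y : inda A, isomorphic (sval X) (inda_of_inda Y).

Record subobject (X : beilinson A) := Subobject {
  sub_ob :> beilinson A;
  incl : hom sub_ob X;
  sub_proa : in_proa sub_ob;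
  sub_quotient : exists (Q : beilinson A) (p : hom X Q),
    conflation incl p /\ in_inda Q }.

Definition subobject_iso (X : beilinson A) (U V : subobject X) :=
  exists f : hom U V, is_iso f /\ incl V ∘ f ≈ incl U.

End Grassmannian.

Definition quotient (T : Type) (R : T -> T -> Prop) :=
  {P : T -> Prop | exists x, P = R x}.

Definition class (T : Type) (R : T -> T -> Prop) (x : T) : quotient R :=
  exist _ (R x) (ex_intro _ x erefl).

Definition Gamma (A : exact_category) (X : beilinson A) :=
  quotient (@subobject_iso A X).

Local Open Scope ring_scope.

Definition dimensional_theory (A : conflation_category) (G : zmodType)
    (chi : A -> G) :=
  forall (a b c : A) (m : hom a b) (p : hom b c),
    conflation m p -> chi b = chi a + chi c.

Section Dimension.
Variables (A : exact_category) (G : zmodType) (chi : A -> G) (X : beilinson A).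

(* The monomorphism m : U -> V is one over X, and a ranges over the objects of A
   that represent V/U. *)
Definition relative_dimensional_theory (d : Gamma X -> G) :=
  forall (U V : subobject X) (m : hom U V), incl V ∘ m ≈ incl U ->
  forall (Q : beilinson A) (p : hom (V : beilinson A) Q), conflation m p ->
  forall a : A, isomorphic (sval Q) (inda_of_base a) ->
    d (class _ V) = d (class _ U) + chi a.

Definition Dim := {d : Gamma X -> G | relative_dimensional_theory d}.

Lemma dim_act_subproof (g : G) (d : Dim) :
  relative_dimensional_theory (fun U => g + sval d U).
Proof.
move=> U V m mX Q p mp a Qa.
by rewrite (svalP d U V m mX Q p mp a Qa) addrA.
Qed.

Definition dim_act (g : G) (d : Dim) : Dim := exist _ _ (dim_act_subproof g d).

End Dimension.

Definition is_torsor (G : zmodType) (S : Type) (act : G -> S -> S) :=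
  [/\ (forall s, act 0 s = s) /\ (forall g h s, act (g + h) s = act g (act h s)),
      forall g s, act g s = s -> g = 0,
      forall s t, exists g, act g s = t
    & exists _ : S, True].

(* Main.v *)
From mathcomp Require Import all_boot all_order all_algebra.
From mathcomp Require Import boolp.
From Stdlib Require Import Setoid Morphisms.
Require Import Defs.

Set Implicit Arguments.
Unset Strict Implicit.
Unset Printing Implicit Defensive.

Import Order.TTheory GRing.Theory Num.Theory.
Local Open Scope cat_scope.

(** The theorem rests on a description of Gamma(X) inside the base category.
    Write [X] as the increasing union of its rows [X_j], the formal limits of the
    [X_(i,j)] over [i].  A member [U] of Gamma(X) is a pro-object, so [U -> X]
    factors through a row; [X/U] is an ind-object, so the composite of that row with
    [X -> X/U] is induced by a map [h : X_(i,j) -> c] of the base category.  (AIC),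
    applied to the graph of [h] and a summand, gives [h] a kernel [n] which is an
    admissible subobject of [X_(i,j)] ([AIC_kernel]), and [U] is the part of [X_j]
    that lies over [n], the pullback of [X_j -> X_(i,j) <- n] ([lattice_exists]).

    The pair (i, j) can be moved.  By cartesianness [X_j] is the part of [X_j'] over
    [X_(i,j)] ([row_pullback]), so that [j] can be raised keeping [n]
    ([lattice_raise]); lowering [i] replaces [n] by its inverse image
    ([lattice_lower]).  Over a common pair, [U -> V] amounts to [n -> n']
    ([lattice_le]), this is an admissible monomorphism by (AIC), and [V/U] is [n'/n]
    ([lattice_conflation]).

    Existence: for [i <= 0 <= j] put d(U) = chi(n) - chi(X_(i,0)), the dimension of
    [U] relative to [X_0].  When [i] is lowered both terms grow by chi of the same
    kernel ([pullback_dimension], [lattice_move]), so [d] is well defined, and it is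
    a relative theory because chi(n') = chi(n) + chi(n'/n).

    Freeness and transitivity: the rows are members of Gamma(X)
    ([row_incl_conflation], [row_beilinson]), so Gamma(X) is not empty; and any
    [U], like [X_0], lies in a row with a quotient in the base category, so the
    difference of two relative theories takes the same value at [U] and at [X_0].

    The only exactness used in the category of ind-pro-objects is that its
    conflations are kernel-cokernel pairs ([ind_exact]); the conflations that have to
    be produced come from [deflation_pullback]. *)

#[local] Hint Extern 0 (heq _ _) => reflexivity : core.

(** * Category generalities *)

Section CategoryFacts.
Variable C : category.

Definition monic (a b : C) (m : hom a b) :=
  forall t (f g : hom t a), m ∘ f ≈ m ∘ g -> f ≈ g.

Lemma iso_comp (a b c : C) (g : hom b c) (f : hom a b) :
  is_iso g -> is_iso f -> is_iso (g ∘ f).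
Proof.
move=> [g' [gg' g'g]] [f' [ff' f'f]]; exists (f' ∘ g'); split.
  by rewrite comp_assoc -(comp_assoc f') gg' comp_idr.
by rewrite comp_assoc -(comp_assoc g) f'f comp_idr.
Qed.

Lemma inverse_is_iso (a b : C) (f : hom a b) (g : hom b a) :
  inverse_pair f g -> is_iso g.
Proof. by move=> [gf fg]; exists f. Qed.

Lemma iso_monic (a b : C) (f : hom a b) : is_iso f -> monic f.
Proof.
move=> [g [gf _]] t u v e.
by rewrite -(comp_idl u) -(comp_idl v) -gf -!comp_assoc e.
Qed.

Lemma isomorphic_sym (a b : C) : isomorphic a b -> isomorphic b a.
Proof. by move=> [f [g fg]]; exists g; apply: inverse_is_iso fg. Qed.

Lemma isomorphic_trans (a b c : C) :
  isomorphic a b -> isomorphic b c -> isomorphic a c.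
Proof. by move=> [f hf] [g hg]; exists (g ∘ f); apply: iso_comp. Qed.

Lemma monic_comp (a b c : C) (g : hom b c) (f : hom a b) :
  monic g -> monic f -> monic (g ∘ f).
Proof. by move=> hg hf t u v; rewrite -!comp_assoc => /hg /hf. Qed.

Lemma iso_seq_trans (a b c a' b' c' a'' b'' c'' : C)
    (f : hom a b) (g : hom b c) (f' : hom a' b') (g' : hom b' c')
    (f'' : hom a'' b'') (g'' : hom b'' c'') :
  iso_seq f g f' g' -> iso_seq f' g' f'' g'' -> iso_seq f g f'' g''.
Proof.
move=> [u [v [w [hu hv hw e1 e2]]]] [u' [v' [w' [hu' hv' hw' e1' e2']]]].
exists (u' ∘ u), (v' ∘ v), (w' ∘ w); split; try exact: iso_comp.
  by rewrite -comp_assoc e1 comp_assoc e1' comp_assoc.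
by rewrite -comp_assoc e2 comp_assoc e2' comp_assoc.
Qed.

Lemma iso_square_sym (a b a' b' : C) (f : hom a b) (f' : hom a' b')
    (u : hom a a') (v : hom b b') (u' : hom a' a) (v' : hom b' b) :
  inverse_pair u u' -> inverse_pair v v' -> v ∘ f ≈ f' ∘ u -> v' ∘ f' ≈ f ∘ u'.
Proof.
move=> [_ uu'] [v'v _] e.
rewrite -(comp_idr f') -uu' (comp_assoc f') -e !comp_assoc v'v comp_idl.
reflexivity.
Qed.

Lemma iso_seq_sym (a b c a' b' c' : C)
    (f : hom a b) (g : hom b c) (f' : hom a' b') (g' : hom b' c') :
  iso_seq f g f' g' -> iso_seq f' g' f g.
Proof.
move=> [u [v [w [[u' hu] [v' hv] [w' hw] e1 e2]]]].
exists u', v', w'; split; try (by apply: inverse_is_iso; eassumption).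
  exact: iso_square_sym e1.
exact: iso_square_sym e2.
Qed.

Lemma pullback_swap (a b c p : C) (f : hom a c) (g : hom b c)
    (f' : hom p a) (g' : hom p b) :
  is_pullback f g f' g' -> is_pullback g f g' f'.
Proof.
move=> [sq un]; split; first by symmetry.
move=> t u v e; have [w [w1 w2 wu]] := un t v u (symmetry e).
by exists w; split=> // w' ? ?; apply: wu.
Qed.

Lemma pullback_heq (a b c p : C) (f f1 : hom a c) (g g1 : hom b c)
    (f' f1' : hom p a) (g' g1' : hom p b) :
  f ≈ f1 -> g ≈ g1 -> f' ≈ f1' -> g' ≈ g1' ->
  is_pullback f g f' g' -> is_pullback f1 g1 f1' g1'.
Proof.
move=> ef eg ef' eg' [sq un]; split; first by rewrite -ef -eg -ef' -eg'.
move=> t u v; rewrite -ef -eg => /un [w [w1 w2 wu]].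
exists w; split; rewrite -?ef' -?eg' // => w'.
by rewrite -ef' -eg'; apply: wu.
Qed.

Lemma pullback_ext (a b c p : C) (f : hom a c) (g : hom b c)
    (f' : hom p a) (g' : hom p b) : is_pullback f g f' g' ->
  forall t (u v : hom t p), f' ∘ u ≈ f' ∘ v -> g' ∘ u ≈ g' ∘ v -> u ≈ v.
Proof.
move=> [sq un] t u v e1 e2.
have [|w [_ _ wu]] := un _ (f' ∘ v) (g' ∘ v); first by rewrite !comp_assoc sq.
by transitivity w; [exact: wu|symmetry; exact: wu].
Qed.

Lemma pullback_monic (a b c p : C) (f : hom a c) (g : hom b c)
    (f' : hom p a) (g' : hom p b) :
  is_pullback f g f' g' -> monic g -> monic f'.
Proof.
move=> pb hg t u v e; apply: (pullback_ext pb) => //.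
by apply: hg; rewrite !comp_assoc -pb.1 -!comp_assoc e.
Qed.

Lemma pullback_paste (a b c d p q : C) (f : hom a b) (h : hom b d) (g : hom c d)
    (x : hom p b) (y : hom p c) (f' : hom q a) (x' : hom q p) :
  is_pullback h g x y -> is_pullback f x f' x' -> is_pullback (h ∘ f) g f' (y ∘ x').
Proof.
move=> [sq1 un1] [sq2 un2]; split.
  by rewrite -comp_assoc sq2 comp_assoc sq1 comp_assoc.
move=> t u v e; rewrite -comp_assoc in e.
have [w [w1 w2 wu]] := un1 _ _ _ e.
have [z [z1 z2 zu]] := un2 _ u w (symmetry w1).
exists z; split=> //; first by rewrite -comp_assoc z2.
move=> z' e1 e2; apply: zu => //; apply: wu; last by rewrite comp_assoc.
by rewrite comp_assoc -sq2 -comp_assoc e1.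
Qed.

Lemma pullback_cancel (a b c d p q : C) (f : hom a b) (h : hom b d) (g : hom c d)
    (x : hom p b) (y : hom p c) (f' : hom q a) (x' : hom q p) :
  is_pullback h g x y -> f ∘ f' ≈ x ∘ x' ->
  is_pullback (h ∘ f) g f' (y ∘ x') -> is_pullback f x f' x'.
Proof.
move=> [sq1 un1] sq [sq2 un2]; split=> // t u v e.
have e1 : h ∘ f ∘ u ≈ g ∘ (y ∘ v) by rewrite -comp_assoc e !comp_assoc sq1.
have [w [w1 w2 wu]] := un2 _ _ _ e1.
exists w; split=> //; last first.
  by move=> w' e2 e3; apply: wu => //; rewrite -comp_assoc e3.
apply: (pullback_ext (conj sq1 un1)); last by rewrite comp_assoc.
by rewrite comp_assoc -sq -comp_assoc w1.
Qed.

Lemma pullback_unique (a b c p q : C) (f : hom a c) (g : hom b c)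
    (f' : hom p a) (g' : hom p b) (f1 : hom q a) (g1 : hom q b) :
  is_pullback f g f' g' -> is_pullback f g f1 g1 ->
  exists w : hom q p, [/\ is_iso w, f' ∘ w ≈ f1 & g' ∘ w ≈ g1].
Proof.
move=> [sq un] [sq1 un1].
have [w [w1 w2 _]] := un _ _ _ sq1; have [z [z1 z2 _]] := un1 _ _ _ sq.
exists w; split=> //; exists z; split.
  by apply: (pullback_ext (conj sq1 un1));
    rewrite comp_assoc ?z1 ?z2 ?w1 ?w2 comp_idr.
by apply: (pullback_ext (conj sq un));
  rewrite comp_assoc ?w1 ?w2 ?z1 ?z2 comp_idr.
Qed.

End CategoryFacts.

Lemma op_iso (C : category) (a b : C) (f : hom a b) :
  is_iso f -> @is_iso (op C) b a f.
Proof. by move=> [g [gf fg]]; exists g. Qed.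

Lemma iso_seq_op (C : category) (a b c a' b' c' : C)
    (f : hom a b) (g : hom b c) (f' : hom a' b') (g' : hom b' c') :
  iso_seq f g f' g' -> @iso_seq (op C) c b a g f c' b' a' g' f'.
Proof.
move=> /iso_seq_sym [u [v [w [hu hv hw e1 e2]]]].
by exists w, v, u; split; try exact: op_iso; symmetry.
Qed.

(** * Zero morphisms, kernels and cokernels *)

(** Kernels and cokernels of pro- and ind-objects are taken with respect to a family
    of zero morphisms, which passes to opposite, full and pro-categories. *)
Record zero_morphisms (C : category) := ZeroMorphisms {
  zmor : forall a b : C, hom a b;
  zmor_l : forall a b c (f : hom a b), zmor b c ∘ f ≈ zmor a c;
  zmor_r : forall a b c (g : hom b c), g ∘ zmor a b ≈ zmor a c }.

Definition zero_op (C : category) (Z : zero_morphisms C) :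
  zero_morphisms (op C) :=
  @ZeroMorphisms (op C) (fun a b => zmor Z b a)
    (fun a b c f => zmor_r Z _ f) (fun a b c f => zmor_l Z _ f).

Definition zero_full (C : category) (P : C -> Prop) (Z : zero_morphisms C) :
  zero_morphisms (full_subcategory P) :=
  @ZeroMorphisms (full_subcategory P) (fun a b => zmor Z (sval a) (sval b))
    (fun a b c f => zmor_l Z _ f) (fun a b c f => zmor_r Z _ f).

Lemma comp_zero_r (C : category) (M : preadditive C) (a b c : C) (g : hom b c) :
  g ∘ hzero M a b ≈ hzero M a c.
Proof.
set x := g ∘ _.
have xx : hadd M x x ≈ x.
  by rewrite /x -comp_haddr; apply: comp_heq; [reflexivity|exact: hadd0].
have e : hadd M (hopp M x) (hadd M x x) ≈ hzero M a c.
  by transitivity (hadd M (hopp M x) x);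
    [apply: hadd_heq; [reflexivity|exact: xx]|exact: haddN].
rewrite -e haddA; symmetry; transitivity (hadd M (hzero M a c) x).
  by apply: hadd_heq; [exact: haddN|reflexivity].
exact: hadd0.
Qed.

Definition zero_of (C : category) (M : preadditive C) : zero_morphisms C :=
  @ZeroMorphisms C (hzero M) (fun a b c f => comp_zero_l M c f)
    (fun a b c g => comp_zero_r M a g).

Definition kernel_of (C : category) (Z : zero_morphisms C) (a b c : C)
    (p : hom b c) (i : hom a b) :=
  p ∘ i ≈ zmor Z a c /\
  forall t (f : hom t b), p ∘ f ≈ zmor Z t c ->
    exists2 u : hom t a, i ∘ u ≈ f & forall u', i ∘ u' ≈ f -> u' ≈ u.

Definition short_exact (C : category) (Z : zero_morphisms C) (a b c : C)
    (m : hom a b) (p : hom b c) :=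
  kernel_of Z p m /\ @kernel_of (op C) (zero_op Z) c b a m p.

Definition exact_conflations (E : conflation_category) (Z : zero_morphisms E) :=
  forall (a b c : E) (m : hom a b) (p : hom b c),
    conflation m p -> short_exact Z m p.

Lemma kernel_monic (C : category) (Z : zero_morphisms C) (a b c : C)
    (p : hom b c) (i : hom a b) : kernel_of Z p i -> monic i.
Proof.
move=> [pi ker] t f g e.
have e0 : p ∘ (i ∘ f) ≈ zmor Z t c by rewrite comp_assoc pi zmor_l.
have [u _ uu] := ker _ _ e0.
by transitivity u; [exact: uu|symmetry; apply: uu; symmetry].
Qed.

Definition epic (C : category) (b c : C) (p : hom b c) :=
  forall t (f g : hom c t), f ∘ p ≈ g ∘ p -> f ≈ g.

Lemma cokernel_epic (C : category) (Z : zero_morphisms C) (a b c : C)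
    (m : hom a b) (p : hom b c) :
  @kernel_of (op C) (zero_op Z) c b a m p -> epic p.
Proof. by move=> /kernel_monic h t f g; apply: h. Qed.

Lemma kernel_iso (C : category) (Z : zero_morphisms C) (a b c a' b' c' : C)
    (f : hom a b) (g : hom b c) (f' : hom a' b') (g' : hom b' c') :
  iso_seq f g f' g' -> kernel_of Z g f -> kernel_of Z g' f'.
Proof.
move=> [u [v [w [[u' hu] [v' hv] [w' hw] e1 e2]]]] [gf ker].
have [[u'u uu'] [v'v vv']] := (hu, hv).
have s1 := iso_square_sym hu hv e1; have s2 := iso_square_sym hv hw e2.
split.
  rewrite -(comp_idr f') -uu' (comp_assoc f') -e1 !comp_assoc -e2.
  by rewrite -(comp_assoc w) gf zmor_r zmor_l.
move=> t x x0.
have e0 : g ∘ (v' ∘ x) ≈ zmor Z t c.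
  by rewrite comp_assoc -s2 -comp_assoc x0 zmor_r.
have [k ik ku] := ker _ _ e0.
exists (u ∘ k).
  by rewrite comp_assoc -e1 -comp_assoc ik comp_assoc vv' comp_idl.
move=> y yx; rewrite -(ku (u' ∘ y)) ?comp_assoc ?uu' ?comp_idl; try reflexivity.
by rewrite -s1 -comp_assoc yx.
Qed.

Lemma short_exact_iso (C : category) (Z : zero_morphisms C) (a b c a' b' c' : C)
    (f : hom a b) (g : hom b c) (f' : hom a' b') (g' : hom b' c') :
  iso_seq f g f' g' -> short_exact Z f g -> short_exact Z f' g'.
Proof.
move=> h [k1 k2]; split; first exact: kernel_iso h k1.
by apply: kernel_iso k2; apply: iso_seq_op.
Qed.

Lemma cokernel_unique (C : category) (Z : zero_morphisms C) (a b c c' a' b': C)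
    (m : hom a b) (p : hom b c) (m' : hom a' b') (p' : hom b' c')
    (u : hom a a') (v : hom b b') : 
  is_iso u -> is_iso v -> v ∘ m ≈ m' ∘ u ->
  short_exact Z m p -> short_exact Z m' p' -> isomorphic c c'.
Proof.
move=> [u' hu] [v' hv] e [_ [/= pm co]] [_ [/= pm' co']].
have s := iso_square_sym hu hv e.
have [[u'u uu'] [v'v vv']] := (hu, hv).
have e1 : p' ∘ v ∘ m ≈ zmor Z a c' by rewrite -comp_assoc e comp_assoc pm' zmor_l.
have e2 : p ∘ v' ∘ m' ≈ zmor Z a' c by rewrite -comp_assoc s comp_assoc pm zmor_l.
have [x xp _] := co _ _ e1; have [y yp _] := co' _ _ e2.
rewrite /= in xp yp.
exists x, y; split.
  apply: (cokernel_epic (conj pm co)).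
  by rewrite /= -comp_assoc xp comp_assoc yp -comp_assoc v'v comp_idr comp_idl.
apply: (cokernel_epic (conj pm' co')).
by rewrite /= -comp_assoc yp comp_assoc xp -comp_assoc vv' comp_idr comp_idl.
Qed.

(** * Exact categories *)

#[local] Instance hadd_Proper (C : category) (M : preadditive C) (a b : C) :
  Proper (heq ==> heq ==> heq) (@hadd C M a b).
Proof. by move=> f f' ef g g' eg; apply: hadd_heq. Qed.

#[local] Instance hopp_Proper (C : category) (M : preadditive C) (a b : C) :
  Proper (heq ==> heq) (@hopp C M a b).
Proof. by move=> f f' ef; apply: hopp_heq. Qed.

Section Preadditive.
Variables (C : category) (M : preadditive C).

Lemma hadd0r (a b : C) (f : hom a b) : hadd M f (hzero M a b) ≈ f.
Proof. by rewrite haddC hadd0. Qed.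

Lemma haddNr (a b : C) (f : hom a b) : hadd M f (hopp M f) ≈ hzero M a b.
Proof. by rewrite haddC haddN. Qed.

Lemma hopp_unique (a b : C) (f g : hom a b) :
  hadd M f g ≈ hzero M a b -> g ≈ hopp M f.
Proof. by move=> fg; rewrite -(hadd0 M g) -(haddN M f) -haddA fg hadd0r. Qed.

Lemma comp_hoppl (a b c : C) (g : hom b c) (f : hom a b) :
  hopp M g ∘ f ≈ hopp M (g ∘ f).
Proof. by apply: hopp_unique; rewrite -comp_haddl haddNr comp_zero_l. Qed.

Lemma comp_hoppr (a b c : C) (g : hom b c) (f : hom a b) :
  g ∘ hopp M f ≈ hopp M (g ∘ f).
Proof. by apply: hopp_unique; rewrite -comp_haddr haddNr comp_zero_r. Qed.

(** The shear automorphism of the biproduct given by [f] carries its inclusions and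
    projections to these ones. *)
Lemma graph_biproduct (a b s : C) (i1 : hom b s) (i2 : hom a s) (p1 : hom s b)
    (p2 : hom s a) (f : hom b a) : is_biproduct M i1 i2 p1 p2 ->
  is_biproduct M (hadd M i1 (i2 ∘ f)) i2 p1 (hadd M p2 (hopp M (f ∘ p1))).
Proof.
move=> [p1i1 p2i2 p1i2 p2i1 e].
have p1g : p1 ∘ hadd M i1 (i2 ∘ f) ≈ idm b.
  by rewrite comp_haddr comp_assoc p1i1 p1i2 comp_zero_l hadd0r.
split=> //.
- rewrite comp_haddl comp_hoppl -comp_assoc p1i2 p2i2 comp_zero_r.
  by rewrite -(hopp_unique (hadd0 M (hzero M a a))) hadd0r.
- rewrite comp_haddl comp_hoppl -comp_assoc p1g comp_haddr comp_assoc.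
  by rewrite p2i1 p2i2 comp_idl comp_idr hadd0 haddNr.
rewrite -e comp_haddl comp_haddr comp_hoppr (comp_assoc i2 f p1) -haddA.
apply: hadd_heq => //.
by rewrite (haddC M (i2 ∘ p2)) haddA haddNr hadd0.
Qed.

End Preadditive.

Section ExactCategory.
Variable A : exact_category.
Let M := exact_additive (exact_axioms A).
Let Z := zero_of M.

Lemma exact_conflations_base : exact_conflations Z.
Proof.
move=> a b c m p mp; split; first exact: (conflation_kernel (exact_axioms A) mp).
exact: (conflation_cokernel (exact_axioms A) mp).
Qed.

Lemma adm_mono_monic (a b : A) (m : hom a b) : adm_mono m -> monic m.
Proof. by move=> [c [p /exact_conflations_base [/kernel_monic]]]. Qed.

Lemma adm_epi_epic (b c : A) (p : hom b c) : adm_epi p -> epic p.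
Proof. by move=> [a [m /exact_conflations_base [_ /cokernel_epic]]]. Qed.

Lemma adm_epi_iso (b c b' c' : A) (p : hom b c) (p' : hom b' c')
    (u : hom b b') (v : hom c c') :
  is_iso u -> is_iso v -> v ∘ p ≈ p' ∘ u -> adm_epi p -> adm_epi p'.
Proof.
move=> hu hv e [a [m mp]]; exists a, (u ∘ m).
apply: (conflation_iso (exact_axioms A) _ mp).
by exists (idm a), u, v; split=> //; [exact: iso_idm|rewrite comp_idr].
Qed.

Lemma adm_mono_iso (b c b' c' : A) (p : hom b c) (p' : hom b' c')
    (u : hom b b') (v : hom c c') :
  is_iso u -> is_iso v -> v ∘ p ≈ p' ∘ u -> adm_mono p -> adm_mono p'.
Proof.
move=> hu [v' hv] e [a [m mp]]; exists a, (m ∘ v').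
apply: (conflation_iso (exact_axioms A) _ mp).
exists u, v, (idm a); split=> //; [by exists v'|exact: iso_idm|].
by rewrite comp_idl -comp_assoc hv.1 comp_idr.
Qed.

Lemma adm_epi_of_pullback (a b c d : A) (p : hom a c) (f : hom b c)
    (f' : hom d a) (p' : hom d b) :
  is_pullback p f f' p' -> adm_epi p -> adm_epi p'.
Proof.
move=> pb hp; have [d1 [f1 [p1 [pb1 hp1]]]] := adm_epi_pullback (exact_axioms A) f hp.
have [w [hw _ e]] := pullback_unique pb pb1.
by apply: (adm_epi_iso hw (iso_idm b)) hp1; rewrite comp_idl e.
Qed.

(** Parallel sides of a cartesian square have the same kernel, and the pullback of an
    admissible epimorphism is one, so chi of the kernel is both differences. *)
Lemma pullback_dimension (G : zmodType) (chi : A -> G)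
    (hchi : dimensional_theory chi) (a b c d : A) (p : hom a c) (f : hom b c)
    (f' : hom d a) (p' : hom d b) :
  is_pullback p f f' p' -> adm_epi p -> (chi d - chi b = chi a - chi c)%R.
Proof.
move=> pb hp; have [k' [i' ip']] := adm_epi_of_pullback pb hp.
have [k [i ip]] := hp; have [[pi0 ker_i] _] := exact_conflations_base ip.
have [[pi0' ker_i'] _] := exact_conflations_base ip'.
have [|w [w1 w2 _]] := pb.2 k i (zmor Z k b); first by rewrite pi0 zmor_r.
have [v vi _] := ker_i' _ w w2.
have [|u ui _] := ker_i _ (f' ∘ i').
  by rewrite comp_assoc pb.1 -comp_assoc pi0' zmor_r.
have mi := kernel_monic (conj pi0 ker_i); have mi' := kernel_monic (conj pi0' ker_i').
have iso_v : is_iso v.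
  exists u; split.
    apply: mi; rewrite comp_assoc ui -comp_assoc vi comp_idr //.
  apply: mi'; rewrite comp_assoc vi comp_idr.
  apply: (pullback_ext pb); first by rewrite comp_assoc w1.
  by rewrite comp_assoc w2 pi0' zmor_l.
have kp' : conflation (i' ∘ v) p'.
  apply: (conflation_iso (exact_axioms A) _ ip'); have [v' hv] := iso_v.
  exists v', (idm d), (idm b); split; try exact: iso_idm.
  - exact: inverse_is_iso hv.
  - by rewrite comp_idl -comp_assoc hv.2 comp_idr.
  - by rewrite comp_idl comp_idr.
by rewrite (hchi _ _ _ _ _ kp') (hchi _ _ _ _ _ ip) !addrK.
Qed.

(** The identity of [a] and an isomorphism [a -> b] are both admissible cokernels of
    the map to [a] from a zero object. *)
Lemma dimension_iso (G : zmodType) (chi : A -> G)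
  (hchi : dimensional_theory chi) (a b : A) : isomorphic a b -> chi a = chi b.
Proof.
move=> [f hf]; have [z hz] := has_zero_object M; have [_ [i _]] := hz a.
have ia : conflation i (idm a) by apply: conflation_zero_id.
have ib : conflation i f.
  apply: (conflation_iso (exact_axioms A) _ ia).
  by exists (idm z), (idm a), f; split;
    rewrite ?comp_idr ?comp_idl //; exact: iso_idm.
by apply: (@addrI _ (chi z)); rewrite -(hchi _ _ _ _ _ ia) (hchi _ _ _ _ _ ib).
Qed.

(** The graph of [f] and the first summand of [b + a] are split subobjects; they
   meet in the kernel of [f]. *)
Lemma AIC_kernel (hA : AIC A) (a b : A) (f : hom b a) :
  exists (n : A) (i : hom n b), kernel_of Z f i /\ adm_mono i.
Proof.
have [s [i1 [i2 [p1 [p2 bp]]]]] := has_biproducts M b a.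
have [p1i1 p2i2 p1i2 p2i1 _] := bp.
have bp' := graph_biproduct f bp; have [p1g _ _ _ _] := bp'.
set g := hadd M i1 _ in bp' p1g.
have hi1 : adm_mono i1 by exists a, p2; apply: (conflation_split bp).
have hg : adm_mono g by eexists; eexists; apply: (conflation_split bp').
have [n [j [k [pb hj hk]]]] := hA _ _ _ _ _ hi1 hg.
(* The projection to [b] is a common retraction of the graph and of the summand. *)
have jk : j ≈ k.
  by rewrite -(comp_idl j) -p1i1 -comp_assoc pb.1 comp_assoc p1g comp_idl.
exists n, k; split=> //; split.
  have <- : p2 ∘ g ≈ f.
    by rewrite comp_haddr comp_assoc p2i1 p2i2 comp_idl hadd0.
  by rewrite -comp_assoc -pb.1 comp_assoc p2i1; apply: comp_zero_l.
move=> t u fu; have [|w [w1 w2 wu]] := pb.2 t u u.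
  by rewrite comp_haddl -comp_assoc fu comp_zero_r hadd0r.
by exists w => // w' w'u; apply: wu; rewrite ?jk.
Qed.

(** The square of [s] and the identity over [n] and [m] is cartesian, so (AIC)
    applies to it. *)
Lemma AIC_cancel (hA : AIC A) (a b c : A) (m : hom a c) (n : hom b c) (s : hom a b) :
  adm_mono m -> adm_mono n -> n ∘ s ≈ m -> adm_mono s.
Proof.
move=> hm hn ns; have [p [m' [n' [pb hm' hn']]]] := hA _ _ _ _ _ hm hn.
have pb' : is_pullback m n (idm a) s.
  split; first by rewrite comp_idr ns.
  move=> t u v uv; exists u; split; rewrite ?comp_idl //.
    by apply: (adm_mono_monic hn); rewrite comp_assoc ns.
  by move=> w' _ e; apply: (adm_mono_monic hm); rewrite -ns -!comp_assoc e -uv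
    comp_assoc ns.
have [w [hw _ e]] := pullback_unique pb' pb.
by apply: (adm_mono_iso hw (iso_idm b)) hn'; rewrite comp_idl e.
Qed.

(** The pushout of [n] along [e] is again a cokernel of [n ∘ m], so it is [c']. *)
Lemma adm_mono_quotient (a b c b' c' : A) (m : hom a b) (e : hom b c)
    (n : hom b b') (e' : hom b' c') (s : hom c c') :
  conflation m e -> conflation (n ∘ m) e' -> adm_mono n -> s ∘ e ≈ e' ∘ n ->
  adm_mono s.
Proof.
move=> me me' hn se.
have [d [f [s' [po hs']]]] := adm_mono_pushout (exact_axioms A) e hn.
have [fn un] := po; rewrite /= in fn.
have [_ [em co]] := exact_conflations_base me.
have [_ [em' co']] := exact_conflations_base me'; rewrite /= in em em'.
have [x xe] : exists x : hom c' d, x ∘ e' ≈ f.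
  have [|x xe _] := co' _ f; last by exists x.
  by rewrite /= comp_assoc fn -comp_assoc em; exact: (zmor_r Z _ s').
have [y [ye ys]] : exists y : hom d c', y ∘ f ≈ e' /\ y ∘ s' ≈ s.
  by have [y [ye ys _]] := un _ e' s (symmetry se); exists y.
have epi_e : epic e by apply: adm_epi_epic; exists a, m.
have epi_e' : epic e' by apply: adm_epi_epic; exists a, (n ∘ m).
have xs : x ∘ s ≈ s' by apply: epi_e; rewrite -comp_assoc se comp_assoc xe.
have iso_y : is_iso y.
  exists x; split.
    apply: (pullback_ext po (u := x ∘ y) (v := idm d));
      by rewrite /= comp_idl -comp_assoc ?ye ?ys.
  by apply: epi_e'; rewrite -comp_assoc xe ye comp_idl.
apply: (adm_mono_iso (iso_idm c) iso_y _ hs').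
by rewrite comp_idr ys.
Qed.

End ExactCategory.

(** * Morphisms of pro-objects *)

Section ProObjects.
Variable C : category.
Implicit Types (X Y T : pro C) (a b c : C).

(** Morphisms of pro-objects are handled through two properties only: a pro-object is
    the limit of the constant pro-objects on its terms ([pro_ext], [pro_lim]), and
    the morphisms to a constant pro-object are the colimit of those from the terms
    ([pproj_factor], [pproj_eqP]). *)
Definition pconst (c : C) : pro C := Proob (const_system point c).

Definition pconst_map (a b : C) (f : hom a b) : hom (pconst a) (pconst b) :=
  formal_lim (const_system_hom point f).

Lemma point_hom_compat (X : proob C) c (g : germ X c) (i j : point) (l : dle i j) :
  germ_eq g (germ_post (smap (const_system point c) l) g).
Proof.
exists (projT1 g), (dle_refl _), (dle_refl _) => /=.
by rewrite comp_idl.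
Qed.

Definition point_hom (X : proob C) c (g : germ X c) : @hom (pro C) X (pconst c) :=
  @Prohom C X (pconst c) (fun _ => g) (@point_hom_compat X c g).

Definition pproj (X : proob C) (k : pidx X) : @hom (pro C) X (pconst (X k)) :=
  point_hom (existT _ k (idm (X k))).

Lemma smap_irr (I : directed_set) (S : system I C) (i j : I) (l l' : dle i j) :
  smap S l ≈ smap S l'.
Proof. by rewrite -(smap_comp S (dle_refl i) l' l) smap_id comp_idl. Qed.

Lemma pconst_map_heq a b (f g : hom a b) : f ≈ g -> pconst_map f ≈ pconst_map g.
Proof. by move=> e t; exists tt, Logic.I, Logic.I; rewrite /= !comp_idr. Qed.

#[export] Instance pconst_map_Proper a b : Proper (heq ==> heq) (@pconst_map a b).
Proof. by move=> f g; apply: pconst_map_heq. Qed.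

Lemma pconst_map_comp a b c (g : hom b c) (f : hom a b) :
  pconst_map (g ∘ f) ≈ pconst_map g ∘ pconst_map f.
Proof. by move=> t; exists tt, Logic.I, Logic.I; rewrite /= !comp_idr. Qed.

Lemma pconst_map_id a : pconst_map (idm a) ≈ idm (pconst a).
Proof. by move=> t; exists tt, Logic.I, Logic.I. Qed.

Lemma pconst_faithful a b (f g : hom a b) : pconst_map f ≈ pconst_map g -> f ≈ g.
Proof. by move=> /(_ tt) [[] [l [l' /=]]]; rewrite !comp_idr. Qed.

Lemma pproj_factor (X : proob C) c (f : @hom (pro C) X (pconst c)) :
  exists k (u : hom (X k) c), f ≈ pconst_map u ∘ pproj k.
Proof.
exists (projT1 (f tt)), (projT2 (f tt)) => -[].
by exists (projT1 (f tt)), (dle_refl _), (dle_refl _); rewrite /= comp_idr.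
Qed.

Lemma pconst_full a b (f : hom (pconst a) (pconst b)) :
  exists u : hom a b, f ≈ pconst_map u.
Proof.
have [[] [u e]] := pproj_factor f; exists u; rewrite e.
by move=> t; exists tt, Logic.I, Logic.I; rewrite /= !comp_idr.
Qed.

Lemma pproj_eqP (X : proob C) c k l (u : hom (X k) c) (v : hom (X l) c) :
  pconst_map u ∘ pproj k ≈ pconst_map v ∘ pproj l <->
  exists m (km : dle k m) (lm : dle l m), u ∘ smap X km ≈ v ∘ smap X lm.
Proof.
split=> [/(_ tt)|] [m [km [lm e]]]; [exists m, km, lm|move=> t; exists m, km, lm].
  by move: e; rewrite /= !comp_idr.
by rewrite /= !comp_idr.
Qed.

Lemma pproj_smap (X : proob C) i j (l : dle i j) :
  pconst_map (smap X l) ∘ pproj j ≈ pproj i.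
Proof.
rewrite -[X in _ ≈ X]comp_idl -pconst_map_id; apply/pproj_eqP.
exists j, (dle_refl j), l; by rewrite smap_id comp_idr comp_idl.
Qed.

Lemma pproj_raise (X : proob C) c k m (km : dle k m) (u : hom (X k) c) :
  pconst_map u ∘ pproj k ≈ pconst_map (u ∘ smap X km) ∘ pproj m.
Proof. by rewrite pconst_map_comp -comp_assoc pproj_smap. Qed.

Lemma pproj_factor2 (X : proob C) a b (f : @hom (pro C) X (pconst a))
    (g : @hom (pro C) X (pconst b)) :
  exists k (u : hom (X k) a) (v : hom (X k) b),
    f ≈ pconst_map u ∘ pproj k /\ g ≈ pconst_map v ∘ pproj k.
Proof.
have [k [u eu]] := pproj_factor f; have [l [v ev]] := pproj_factor g.
have [m [km lm]] := dle_directed k l.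
by exists m, (u ∘ smap X km), (v ∘ smap X lm);
  split; rewrite ?eu ?ev; apply: pproj_raise.
Qed.

Lemma pproj_eq_raise (X : proob C) c k (u v : hom (X k) c) :
  pconst_map u ∘ pproj k ≈ pconst_map v ∘ pproj k ->
  exists m (km : dle k m), u ∘ smap X km ≈ v ∘ smap X km.
Proof.
by move=> /pproj_eqP [m [km [km' e]]]; exists m, km; rewrite e; apply: comp_heq;
  [|exact: smap_irr].
Qed.

Lemma pproj_comp (X Y : proob C) (f : @hom (pro C) X Y) j :
  pproj j ∘ f ≈ point_hom (f j).
Proof.
by move=> t; exists (projT1 (f j)), (dle_refl _), (dle_refl _); rewrite /= comp_idl.
Qed.

Lemma pro_ext (X Y : proob C) (f g : @hom (pro C) X Y) :
  (forall j, pproj j ∘ f ≈ pproj j ∘ g) -> f ≈ g.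
Proof. by move=> e j; have := e j; rewrite !pproj_comp => /(_ tt). Qed.

(** A pro-object is the limit of its terms; the components are given by a
    relation so that they may be specified by a property only. *)
Lemma pro_lim (X Y : proob C)
    (R : forall j : pidx Y, @hom (pro C) X (pconst (Y j)) -> Prop) :
  (forall j, exists h, R j h) ->
  (forall j j' (l : dle j j') h h', R j h -> R j' h' ->
    h ≈ pconst_map (smap Y l) ∘ h') ->
  exists f : @hom (pro C) X Y, forall j, exists2 h, R j h & pproj j ∘ f ≈ h.
Proof.
move=> ex co; pose h j := projT1 (cid (ex j)).
have hR j : R j (h j) := projT2 (cid (ex j)).
have compat j j' (l : dle j j') :
    germ_eq (h j tt) (germ_post (smap Y l) (h j' tt)).
  exact: (co j j' l _ _ (hR j) (hR j') tt).
exists (@Prohom C X Y (fun j => h j tt) compat) => j; exists (h j) => //.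
by rewrite pproj_comp; case; apply: Equivalence_Reflexive.
Qed.

Lemma formal_lim_proj (I : directed_set) (S T : system I C) (m : system_hom S T) i :
  @pproj (Proob T) i ∘ formal_lim m ≈ pconst_map (m i) ∘ @pproj (Proob S) i.
Proof.
move=> t; exists i, (dle_refl i), (dle_refl i).
by rewrite /= !comp_idr comp_idl.
Qed.

(** Filtered colimits of sets commute with finite limits. *)
Lemma pconst_pullback a b c p (f : hom a c) (g : hom b c)
    (f' : hom p a) (g' : hom p b) : is_pullback f g f' g' ->
  is_pullback (pconst_map f) (pconst_map g) (pconst_map f') (pconst_map g').
Proof.
move=> pb; split; first by rewrite -!pconst_map_comp pb.1.
move=> X u v uv.
have [k [u0 [v0 [eu ev]]]] := pproj_factor2 u v.
have /pproj_eq_raise [m [km e]] :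
    pconst_map (f ∘ u0) ∘ pproj k ≈ pconst_map (g ∘ v0) ∘ pproj k.
  by rewrite !pconst_map_comp -!comp_assoc -eu -ev.
rewrite -!comp_assoc in e; have [w [w1 w2 _]] := pb.2 _ _ _ e.
exists (pconst_map w ∘ pproj m); split.
- by rewrite comp_assoc -pconst_map_comp w1 -pproj_raise eu.
- by rewrite comp_assoc -pconst_map_comp w2 -pproj_raise ev.
move=> w' e1 e2; have [l [z ez]] := pproj_factor w'.
move: e1 e2; rewrite ez eu ev !comp_assoc -!pconst_map_comp.
move=> /pproj_eqP [n1 [l1 [k1 e1]]] /pproj_eqP [n2 [l2 [k2 e2]]].
have [n [nn1 nn2]] := dle_directed n1 n2.
have [q [nq mq]] := dle_directed n m.
apply/pproj_eqP; have lq : dle l q by exact: dle_trans l1 (dle_trans nn1 nq).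
exists q, lq, mq; apply: (pullback_ext pb).
  rewrite !comp_assoc w1 -(comp_assoc u0) (smap_comp X km mq (dle_trans km mq)).
  have n1q := dle_trans nn1 nq.
  rewrite -(smap_comp X l1 n1q lq) comp_assoc e1.
  by rewrite -comp_assoc (smap_comp X _ _ (dle_trans km mq)).
rewrite !comp_assoc w2 -(comp_assoc v0) (smap_comp X km mq (dle_trans km mq)).
have n2q := dle_trans nn2 nq.
rewrite -(smap_comp X l2 n2q lq) comp_assoc e2.
by rewrite -comp_assoc (smap_comp X _ _ (dle_trans km mq)).
Qed.

Lemma pconst_monic a b (m : hom a b) : monic m -> monic (pconst_map m).
Proof.
move=> hm; have pb : is_pullback m m (idm a) (idm a).
  split=> // t u v /hm e; exists u; split; rewrite ?comp_idl // => w.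
  by rewrite !comp_idl.
move=> T u v e; have [_ un] := pconst_pullback pb.
have [w [w1 w2 _]] := un _ _ _ e.
by rewrite -w1 -w2.
Qed.

Section Reindex.
Variables (I J : directed_set) (S : system I C) (phi : J -> I).
Hypothesis phi_mono : forall j j', dle j j' -> dle (phi j) (phi j').
Hypothesis phi_cofinal : forall i, exists j, dle i (phi j).

Program Definition reindex : system J C :=
  {| sob := fun j => S (phi j); smap := fun i j l => smap S (phi_mono l) |}.
Next Obligation. exact: smap_id. Qed.
Next Obligation. exact: smap_comp. Qed.

Lemma reindex_compat j j' (l : dle j j') :
  germ_eq (existT _ (phi j) (idm _) : germ (Proob S) (reindex j))
    (germ_post (smap reindex l) (existT _ (phi j') (idm _) : germ (Proob S) _)).
Proof.
exists (phi j'), (phi_mono l), (dle_refl _).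
by rewrite /= comp_idl comp_idr smap_id comp_idr.
Qed.

Definition reindex_hom : @hom (pro C) (Proob S) (Proob reindex) :=
  @Prohom C (Proob S) (Proob reindex) _ reindex_compat.

Lemma reindex_homE j : @pproj (Proob reindex) j ∘ reindex_hom ≈ @pproj (Proob S) (phi j).
Proof.
move=> t; exists (phi j), (dle_refl _), (dle_refl _).
by rewrite /= comp_idl.
Qed.

(** A germ at [i] is moved to any [phi j] beyond [i]. *)
Lemma reindex_iso : is_iso reindex_hom.
Proof.
pose R i (h : @hom (pro C) (Proob reindex) (pconst (S i))) := exists j (l : dle i (phi j)),
  h ≈ pconst_map (smap S l) ∘ @pproj (Proob reindex) j.
have ex i : exists h, R i h.
  have [j l] := phi_cofinal i.
  by exists (pconst_map (smap S l) ∘ @pproj (Proob reindex) j), j, l.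
have [|f hf] := @pro_lim (Proob reindex) (Proob S) R ex.
  move=> i i' l h h' [j [k eh]] [j' [k' eh']]; rewrite eh eh' comp_assoc -pconst_map_comp.
  have [m [jm jm']] := dle_directed j j'.
  apply/pproj_eqP; exists m, jm, jm' => /=.
  rewrite (smap_comp S k _ (dle_trans k (phi_mono jm))).
  rewrite -comp_assoc (smap_comp S k' _ (dle_trans k' (phi_mono jm'))).
  by rewrite (smap_comp S _ _ (dle_trans k (phi_mono jm))).
exists f; split; apply: pro_ext => j.
  have [h [i [l eh]] fj] := hf j.
  rewrite comp_assoc fj eh -comp_assoc reindex_homE comp_idr.
  exact: (@pproj_smap (Proob S)).
have [h [i [l eh]] fj] := hf (phi j).
rewrite comp_assoc reindex_homE fj eh comp_idr.
have [m [jm im]] := dle_directed j i.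
rewrite (@pproj_raise (Proob reindex) _ _ _ im) -(@pproj_smap (Proob reindex) _ _ jm).
apply: comp_heq => //; apply: pconst_map_heq => /=.
by rewrite (smap_comp S _ _ (phi_mono jm)).
Qed.

End Reindex.

Lemma const_proj_iso (I : directed_set) c (i0 : I) :
  is_iso (@pproj (Proob (const_system I c)) i0).
Proof.
have ex (i : I) : exists h : hom (pconst c) (pconst c), h ≈ idm _.
  by exists (idm _).
have [|f hf] := @pro_lim (pconst c) (Proob (const_system I c))
   (fun i h => h ≈ idm (pconst c)) ex.
  move=> i j l h h' e e'; rewrite e e'.
  transitivity (pconst_map (idm c) ∘ idm (pconst c)) => //.
  by rewrite pconst_map_id comp_idl.
exists f; split; last by have [h -> ->] := hf i0.
apply: pro_ext => i; have [h e1 e2] := hf i; rewrite comp_assoc e2 e1 comp_idl comp_idr.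
have [m [im i0m]] := dle_directed i i0.
rewrite -(@pproj_smap (Proob (const_system I c)) _ _ im).
by rewrite -(@pproj_smap (Proob (const_system I c)) _ _ i0m).
Qed.

Variable Z : zero_morphisms C.

Definition some_index (I : directed_set) : I := projT1 (cid (dle_inhabited I)).

(** The zero germ has to live at some index, and none is distinguished. *)
Definition pzero_germ (X : proob C) c : germ X c :=
  existT _ (some_index _) (zmor Z _ c).

Lemma germ_zeroP (X : proob C) c (g : germ X c) :
  germ_eq g (pzero_germ X c) <->
  exists m (km : dle (projT1 g) m), projT2 g ∘ smap X km ≈ zmor Z _ c.
Proof.
split=> [[m [km [l e]]]|[m [km e]]]; first by exists m, km; rewrite e /= zmor_l.
have [n [mn sn]] := dle_directed m (some_index (pidx X)).
exists n, (dle_trans km mn), sn; rewrite /= zmor_l.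
by rewrite -(smap_comp X km mn) comp_assoc e zmor_l.
Qed.

Lemma pzero_compat (X Y : proob C) j j' (l : dle j j') :
  germ_eq (pzero_germ X (Y j)) (germ_post (smap Y l) (pzero_germ X (Y j'))).
Proof.
symmetry; apply/germ_zeroP; exists (some_index _), (dle_refl _).
by rewrite /= zmor_r zmor_l.
Qed.

Definition pzero (X Y : proob C) : prohom X Y := Prohom (@pzero_compat X Y).

Lemma pzero_l (X Y W : proob C) (f : prohom X Y) :
  @heq (pro C) _ _ (@comp (pro C) X Y W (pzero Y W) f) (pzero X W).
Proof.
move=> k; apply/germ_zeroP; exists (projT1 (f (some_index _))), (dle_refl _) => /=.
by rewrite zmor_l zmor_l.
Qed.

Lemma pzero_r (X Y W : proob C) (g : prohom Y W) :
  @heq (pro C) _ _ (@comp (pro C) X Y W g (pzero X Y)) (pzero X W).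
Proof.
move=> k; apply/germ_zeroP; exists (some_index _), (dle_refl _) => /=.
by rewrite zmor_r zmor_l.
Qed.

Definition zero_pro : zero_morphisms (pro C) :=
  @ZeroMorphisms (pro C) pzero (fun X Y W f => @pzero_l X Y W f)
    (fun X Y W g => @pzero_r X Y W g).

Lemma pproj_zeroP (X : proob C) c k (u : hom (X k) c) :
  pconst_map u ∘ pproj k ≈ zmor zero_pro _ _ <->
  exists m (km : dle k m), u ∘ smap X km ≈ zmor Z _ c.
Proof.
split=> [/(_ tt)|] h.
  have [m [km e]] := (germ_zeroP _).1 h; exists m, km; move: e.
  by rewrite /= !comp_idr.
move=> t; apply/germ_zeroP; have [m [km e]] := h; exists m, km.
by rewrite /= !comp_idr.
Qed.

Lemma pconst_zero a b : pconst_map (zmor Z a b) ≈ zmor zero_pro (pconst a) (pconst b).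
Proof.
by move=> t; apply/germ_zeroP; exists tt, Logic.I; rewrite /= comp_idr.
Qed.

Section LevelwiseExact.
Variables (I : directed_set) (S T U : system I C).
Variables (m : system_hom S T) (p : system_hom T U).

(** A morphism to [T] killed by [p] is killed, at each [i], after restriction to a
    far enough index, hence lifts to [S i]; the lifts agree as the [m i] are monic. *)
Lemma pro_kernel : (forall i, kernel_of Z (p i) (m i)) ->
  kernel_of zero_pro (formal_lim p) (formal_lim m).
Proof.
move=> ker; split.
  move=> i; apply/germ_zeroP; exists i, (dle_refl i) => /=.
  by rewrite (ker i).1 zmor_l.
move=> X f pf0.
have mono_m i := pconst_monic (kernel_monic (ker i)).
have ex i : exists h : hom X (pconst (S i)),
    pconst_map (m i) ∘ h ≈ @pproj (Proob T) i ∘ f.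
  have [k [u eu]] := pproj_factor (@pproj (Proob T) i ∘ f).
  have e0 : pconst_map (p i ∘ u) ∘ pproj k ≈ zmor zero_pro _ _.
    rewrite pconst_map_comp -comp_assoc -eu comp_assoc -formal_lim_proj.
    by rewrite -comp_assoc pf0 zmor_r.
  have [n [kn e]] := (pproj_zeroP _).1 e0.
  rewrite -comp_assoc in e; have [s ms _] := (ker i).2 _ _ e.
  exists (pconst_map s ∘ pproj n).
  by rewrite comp_assoc -pconst_map_comp ms -pproj_raise eu.
have [|s hs] := @pro_lim X (Proob S) _ ex.
  move=> i j l h h' e e'; apply: mono_m.
  rewrite e comp_assoc -pconst_map_comp shom_nat pconst_map_comp -comp_assoc e'.
  by rewrite comp_assoc (@pproj_smap (Proob T)).
exists s.
  apply: pro_ext => i; have [h e1 e2] := hs i.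
  by rewrite comp_assoc formal_lim_proj -comp_assoc e2.
move=> s' e; apply: pro_ext => i; apply: mono_m; have [h e1 e2] := hs i.
by rewrite e2 e1 comp_assoc -formal_lim_proj -comp_assoc e.
Qed.

(** A morphism from [T] to a constant object is represented on some [T i]; if it
    kills [m], then it kills [m n] for a later [n], and factors through [U n]. *)
Lemma pro_cokernel :
  (forall i, @kernel_of (op C) (zero_op Z) (U i) (T i) (S i) (m i) (p i)) ->
  @kernel_of (op (pro C)) (zero_op zero_pro) (Proob U) (Proob T) (Proob S)
    (formal_lim m) (formal_lim p).
Proof.
move=> coker; have epi i : epic (p i) := cokernel_epic (coker i).
have pm0 i : p i ∘ m i ≈ zmor Z _ _ := (coker i).1.
have epi_lim : @epic (pro C) _ _ (formal_lim p).
  move=> X f g e; apply: pro_ext => j.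
  have [i [u [v [eu ev]]]] := pproj_factor2 (pproj j ∘ f) (pproj j ∘ g).
  have : pproj j ∘ f ∘ formal_lim p ≈ pproj j ∘ g ∘ formal_lim p.
    by rewrite -!comp_assoc e.
  rewrite eu ev -!comp_assoc formal_lim_proj !comp_assoc -!pconst_map_comp.
  move=> /(@pproj_eq_raise (Proob T)) [n [k]]; rewrite -!comp_assoc !shom_nat !comp_assoc.
  by move=> /epi e'; apply/(@pproj_eqP (Proob U)); exists n, k, k.
split.
  move=> i; apply/germ_zeroP; exists i, (dle_refl i) => /=.
  by rewrite pm0 zmor_l.
move=> X; change (forall f : @hom (pro C) (Proob T) X,
  f ∘ formal_lim m ≈ zmor zero_pro (Proob S) X ->
  exists2 u : @hom (pro C) (Proob U) X, u ∘ formal_lim p ≈ f &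
    forall u' : @hom (pro C) (Proob U) X, u' ∘ formal_lim p ≈ f -> u' ≈ u).
move=> f fm0.
have ex j : exists h : @hom (pro C) (Proob U) (pconst (psys X j)),
    h ∘ formal_lim p ≈ pproj j ∘ f.
  have [i [u eu]] := pproj_factor (pproj j ∘ f).
  have e0 : pconst_map (u ∘ m i) ∘ @pproj (Proob S) i ≈ zmor zero_pro _ _.
    rewrite pconst_map_comp -comp_assoc -formal_lim_proj comp_assoc -eu.
    by rewrite -comp_assoc fm0; exact: (zmor_r zero_pro).
  have [n [k e]] := (@pproj_zeroP (Proob S) _ _ _).1 e0.
  rewrite -comp_assoc shom_nat comp_assoc in e.
  have [w wp _] := (coker n).2 _ _ e; rewrite /= in w wp.
  exists (pconst_map w ∘ @pproj (Proob U) n).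
  rewrite -comp_assoc formal_lim_proj comp_assoc -pconst_map_comp wp.
  by rewrite -(@pproj_raise (Proob T)) eu.
have [|s hs] := @pro_lim (Proob U) X _ ex.
  move=> i j l h h' e e'; apply: epi_lim.
  by rewrite e -comp_assoc e' comp_assoc pproj_smap.
have sf : s ∘ formal_lim p ≈ f.
  by apply: pro_ext => i; have [h e1 e2] := hs i; rewrite comp_assoc e2.
by exists s => // s' e; apply: epi_lim; rewrite sf.
Qed.

End LevelwiseExact.

End ProObjects.

(** * Admissible pro-objects *)

Section Conflations.
Variable E : conflation_category.

Lemma proa_conflation_iso (X Y W X' Y' W' : proa E) (f : hom X Y) (g : hom Y W)
    (f' : hom X' Y') (g' : hom Y' W') :
  iso_seq f g f' g' -> conflation f g -> conflation f' g'.
Proof.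
move=> h [I [S [T [U [hS [hT [hU [m [p [mp h']]]]]]]]]].
exists I, S, T, U, hS, hT, hU, m, p; split=> //; exact: iso_seq_trans h' h.
Qed.

Lemma proa_const_conflation (a b c : E)
    (ha : @admissible_system E _ (const_system point a))
    (hb : @admissible_system E _ (const_system point b))
    (hc : @admissible_system E _ (const_system point c)) (f : hom a b) (g : hom b c) :
  conflation f g ->
  @conflation (proa E) (mk_proa ha) (mk_proa hb) (mk_proa hc)
    (pconst_map f) (pconst_map g).
Proof.
move=> fg; exists point, (const_system point a), (const_system point b),
  (const_system point c), ha, hb, hc, (const_system_hom point f), (const_system_hom point g).
by split=> //; apply: iso_seq_refl.
Qed.

Lemma proa_exact (Z : zero_morphisms E) : exact_conflations Z ->
  @exact_conflations (proa E) (zero_full _ (zero_pro Z)).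
Proof.
move=> hZ X Y W f g [I [S [T [U [hS [hT [hU [m [p [mp h]]]]]]]]]].
apply: short_exact_iso h _.
have [ker coker] : short_exact (zero_pro Z) (formal_lim m) (formal_lim p).
  split; first by apply: pro_kernel => i; case: (hZ _ _ _ _ _ (mp i)).
  by apply: pro_cokernel => i; case: (hZ _ _ _ _ _ (mp i)).
split; split; [exact: ker.1| |exact: coker.1|].
  by move=> t x /ker.2.
by move=> t x /coker.2.
Qed.

Lemma op_exact (Z : zero_morphisms E) : exact_conflations Z ->
  @exact_conflations (conflation_op E) (zero_op Z).
Proof. by move=> hZ a b c m p /hZ [k1 k2]; split. Qed.

End Conflations.

Lemma full_pullback (C : category) (P : C -> Prop) (a b c p : full_subcategory P)
    (f : hom a c) (g : hom b c) (f' : hom p a) (g' : hom p b) :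
  @is_pullback C (sval a) (sval b) (sval c) (sval p) f g f' g' ->
  is_pullback f g f' g'.
Proof. by move=> [sq un]; split=> // t u v /un. Qed.

Section AdmissiblePro.
Variable A : exact_category.

(** These are the maps to a constant pro-object along which an admissible subobject
    can be pulled back term by term. *)
Definition pro_deflation (X : pro A) c (y : hom X (pconst c)) :=
  exists k (u : hom (psys X k) c), adm_epi u /\ y ≈ pconst_map u ∘ pproj k.

Lemma pro_deflation_epic (X : proa A) c (y : @hom (pro A) (sval X) (pconst c)) d
    (f g : hom c d) :
  pro_deflation y -> pconst_map f ∘ y ≈ pconst_map g ∘ y -> f ≈ g.
Proof.
move=> [k [u [hu ey]]].
rewrite ey !comp_assoc -!pconst_map_comp => /pproj_eq_raise [m [km]].
rewrite -!comp_assoc => e; apply: (adm_epi_epic _ e).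
by apply: adm_epi_comp hu; [exact: exact_axioms|exact: (svalP X)].
Qed.

(** The pullback is formed from the pullbacks of the terms at the indices beyond [k],
    where [y] is represented.  Its transition maps are admissible epimorphisms since
    each is a pullback of a transition map of [S]. *)
Section DeflationPullback.
Variables (I : directed_set) (S : system I A).
Hypothesis hS : admissible_system S.
Variables (c n b : A) (k : I) (u : hom (S k) c) (m : hom n c) (e : hom c b).
Hypotheses (hu : adm_epi u) (me : conflation m e).

Let dleb i : bool := `[< dle k i >].
Let J0 : countType := {i : I | dleb i}.
Let J0dir (i j : J0) : exists l : J0, dle (val i) (val l) /\ dle (val j) (val l).
Proof.
have [l [il jl]] := dle_directed (val i) (val j).
have kl : dleb l by apply/asboolP; apply: dle_trans il; exact/asboolP/(valP i).
by exists (exist _ l kl).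
Qed.
Let k0 : J0 := exist _ k (introT (asboolP _) (dle_refl k)).
Let J : directed_set := @DirectedSet J0 (fun i j => dle (val i) (val j))
  (fun i => dle_refl (val i)) (fun i j l ij jl => dle_trans ij jl) J0dir
  (ex_intro _ k0 Logic.I).
Let phi (j : J) : I := val j.
Let kphi (j : J) : dle k (phi j) := elimT (asboolP _) (valP j).
Let uphi (j : J) : hom (S (phi j)) c := u ∘ smap S (kphi j).

Let uphi_epi j : adm_epi (uphi j).
Proof. by apply: adm_epi_comp hu; [exact: exact_axioms|exact: hS]. Qed.

Let data j : {P : A & {f : hom P (S (phi j)) & {q : hom P n |
  is_pullback (uphi j) m f q /\ adm_epi q}}}.
Proof.
have /cid [P] := adm_epi_pullback (exact_axioms A) m (uphi_epi j).
move=> /cid [f] /cid [q h]; exists P, f.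
exact: (exist _ q h).
Qed.
Let P j := projT1 (data j).
Let f j : hom (P j) (S (phi j)) := projT1 (projT2 (data j)).
Let q j : hom (P j) n := sval (projT2 (projT2 (data j))).
Let pb j : is_pullback (uphi j) m (f j) (q j).
Proof. exact: (svalP (projT2 (projT2 (data j)))).1. Qed.
Let q_epi j : adm_epi (q j).
Proof. exact: (svalP (projT2 (projT2 (data j)))).2. Qed.

Let m_monic : monic m.
Proof. by apply: adm_mono_monic; exists b, e. Qed.
Let f_monic j : monic (f j).
Proof. exact: pullback_monic (pb j) m_monic. Qed.

Let uphi_smap i j (l : dle (phi i) (phi j)) : uphi i ∘ smap S l ≈ uphi j.
Proof.
rewrite /uphi -comp_assoc (smap_comp S (kphi i) l (kphi j)); reflexivity.
Qed.

Let trans i j (l : dle i j) : {w : hom (P j) (P i) |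
  f i ∘ w ≈ smap S (l : dle (phi i) (phi j)) ∘ f j /\ q i ∘ w ≈ q j}.
Proof.
apply: cid; have [|w [w1 w2 _]] := (pb i).2 _ (smap S (l : dle (phi i) (phi j)) ∘ f j) (q j).
  by rewrite comp_assoc uphi_smap (pb j).1.
by exists w.
Qed.

#[local] Obligation Tactic := idtac.
Program Definition pullback_system : system J A :=
  {| sob := P; smap := fun i j l => sval (trans l) |}.
Next Obligation.
move=> i l; apply: f_monic; have [e1 _] := svalP (trans l).
by rewrite e1 smap_id comp_idl comp_idr.
Qed.
Next Obligation.
move=> i j h l l' l''; apply: f_monic.
have [e1 _] := svalP (trans l); have [e2 _] := svalP (trans l').
have [e3 _] := svalP (trans l''); rewrite comp_assoc e1 -comp_assoc e2 e3 comp_assoc.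
apply: comp_heq => //; exact: smap_comp.
Qed.

Lemma pullback_system_admissible : admissible_system pullback_system.
Proof.
move=> i j l; have [e1 e2] := svalP (trans l).
apply: (@adm_epi_of_pullback A _ _ _ _ (smap S (l : dle (phi i) (phi j)))
  (f i) (f j)); last exact: hS.
apply: pullback_cancel (pb i) _ _; first by symmetry.
by apply: pullback_heq (pb j) => //; symmetry; [exact: uphi_smap|].
Qed.

Let phi_mono i j : dle i j -> dle (phi i) (phi j).
Proof. by []. Qed.
Let phi_cofinal i : exists j, dle i (phi j).
Proof.
have [l [il kl]] := dle_directed i k.
by exists (exist _ l (introT (asboolP _) kl)).
Qed.
Let S' := reindex S phi_mono.

Program Definition pullback_incl : system_hom pullback_system S' := {| shom := f |}.
Next Obligation.
move=> i j l; have [e1 _] := svalP (trans l); rewrite /= e1.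
by apply: comp_heq => //; exact: smap_irr.
Qed.

Program Definition pullback_quotient : system_hom S' (const_system J b) :=
  {| shom := fun j => e ∘ uphi j |}.
Next Obligation.
by move=> i j l; rewrite -comp_assoc; rewrite /= comp_idl uphi_smap.
Qed.

Lemma deflation_pullback_system (X := mk_proa hS : proa A)
    (y := pconst_map u ∘ @pproj _ (Proob S) k : @hom (pro A) (Proob S) (pconst c)) :
  exists (Y : proa A) (f : hom Y X) (g : hom Y (const_proa n)),
  [/\ @is_pullback (pro A) _ _ _ (sval Y) y (pconst_map m) f g,
      @conflation (proa A) Y X (const_proa b) f (pconst_map e ∘ y)
    & pro_deflation g].
Proof.
pose Y := mk_proa pullback_system_admissible.
have [r' [r'r rr']] := reindex_iso S phi_mono phi_cofinal.
set r := reindex_hom _ _ in r'r rr'.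
have proj_r j : @pproj _ (Proob S) (phi j) ∘ r' ≈ @pproj _ (Proob S') j.
  by rewrite -(@reindex_homE A I J S phi phi_mono j) -comp_assoc rr' comp_idr.
pose F : @hom (pro A) (sval Y) (Proob S) := r' ∘ formal_lim pullback_incl.
have projF j : @pproj _ (Proob S) (phi j) ∘ F ≈ pconst_map (f j) ∘ @pproj _ (sval Y) j.
  by rewrite /F comp_assoc proj_r formal_lim_proj.
pose G := pconst_map (q k0) ∘ @pproj _ (sval Y) k0.
have uphiE j : pconst_map (uphi j) ∘ @pproj _ (Proob S) (phi j) ≈ y.
  by rewrite /uphi /y -(@pproj_raise _ (Proob S)).
have sq : y ∘ F ≈ pconst_map m ∘ G.
  rewrite -(uphiE k0) -comp_assoc (projF k0) /G !comp_assoc -!pconst_map_comp.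
  by rewrite (pb k0).1.
have Fmono : @monic (pro A) _ _ F.
  apply: monic_comp; first by apply: iso_monic; exists r.
  move=> T x z ez; apply: (@pro_ext _ T (sval Y)) => j.
  apply: (pconst_monic (@f_monic j)).
  by rewrite !comp_assoc -!(formal_lim_proj pullback_incl) -!comp_assoc ez.
exists Y, F, G; split.
- split=> // T a v av.
  pose R j (h : @hom (pro A) T (pconst (P j))) :=
    pconst_map (f j) ∘ h ≈ @pproj _ (Proob S) (phi j) ∘ a.
  have ex j : exists h, R j h.
    have [|h [h1 _ _]] := (pconst_pullback (pb j)).2 T (@pproj _ (Proob S) (phi j) ∘ a) v.
      by rewrite comp_assoc uphiE.
    by exists h.
  have [|w hw] := @pro_lim _ T (sval Y) R ex.
    rewrite /R => i j l h h' e1 e2; apply: (pconst_monic (@f_monic i)).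
    rewrite e1 comp_assoc -pconst_map_comp (shom_nat pullback_incl l).
    by rewrite pconst_map_comp -comp_assoc e2 comp_assoc (@pproj_smap _ (Proob S)).
  have Fw : F ∘ w ≈ a.
    have E j : @pproj _ (Proob S) (phi j) ∘ (F ∘ w) ≈ @pproj _ (Proob S) (phi j) ∘ a.
      have [h h1 h2] := hw j; rewrite /R in h1.
      by rewrite comp_assoc (projF j) -comp_assoc h2 h1.
    apply: (@pro_ext _ T (Proob S)) => i; have [j ij] := phi_cofinal i.
    rewrite -(@pproj_smap _ (Proob S) _ _ ij) -!(comp_assoc (pconst_map _)); apply: comp_heq => //.
  exists w; split=> //.
    by apply: (pconst_monic m_monic); rewrite comp_assoc -sq -comp_assoc Fw.
  by move=> w' e1 _; apply: Fmono; transitivity a; [exact: e1|symmetry; exact: Fw].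
- pose t := @pproj _ (Proob (const_system J b)) k0.
  have ht : @is_iso (pro A) _ _ t.
    exact: const_proj_iso.
  have hS' : admissible_system S' by move=> i j l; apply: hS.
  apply: (@proa_conflation_iso A Y (mk_proa hS') (mk_proa (const_admissible A J b))
    Y X (const_proa b) (formal_lim pullback_incl) (formal_lim pullback_quotient)).
    exists (idm Y), r', t; split.
    - exact: iso_idm.
    - by exists r.
    - exact: ht.
    - exact: (symmetry (@comp_idr (pro A) _ _ _)).
    change (t ∘ formal_lim pullback_quotient ≈ pconst_map e ∘ y ∘ r').
    rewrite /t formal_lim_proj -(uphiE k0) !comp_assoc -pconst_map_comp.
    by rewrite -comp_assoc proj_r.
  exists J, pullback_system, S', (const_system J b), pullback_system_admissible,
    hS', (const_admissible A J b), pullback_incl, pullback_quotient.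
  split; last exact: (@iso_seq_refl (proa A)).
  by move=> j; apply: (pullback_conflation (pb j)).
by exists k0, (q k0); split.
Qed.

End DeflationPullback.

(** Conflations of pro-objects with a constant quotient come from here; the map to
    [n] is again a deflation, so the construction can be iterated. *)
Lemma deflation_pullback (X : proa A) c n b (y : hom X (const_proa c))
    (m : hom n c) (e : hom c b) :
  @pro_deflation (sval X) c y -> conflation m e ->
  exists (Y : proa A) (f : hom Y X) (g : hom Y (const_proa n)),
  [/\ is_pullback y (const_proa_map m) f g, conflation f (const_proa_map e ∘ y)
    & @pro_deflation (sval Y) n g].
Proof.
case: X y => [[I S] hS] y [k [u [hu ey]]] me.
have [Y [f [g [pb cf dg]]]] := deflation_pullback_system hS hu me.
exists Y, f, g; split=> //.
  apply: full_pullback; apply: pullback_heq pb => //; symmetry; exact: ey.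
apply: proa_conflation_iso cf; exists (idm Y), (idm _), (idm _); split;
  try exact: iso_idm.
  by rewrite comp_idl comp_idr.
rewrite comp_idl comp_idr.
by apply: (@comp_heq (pro A)); [reflexivity|symmetry; exact: ey].
Qed.

End AdmissiblePro.

(** * Ind-objects of pro-objects *)

Section IndPro.
Variable A : exact_category.
Notation K := (proa A).
Notation W := (inda (proa A)).

Definition pro_zero_morphisms : zero_morphisms K :=
  zero_full _ (zero_pro (zero_of (exact_additive (exact_axioms A)))).

Definition ind_zero_morphisms : zero_morphisms W :=
  zero_op (zero_full _ (zero_pro (zero_op pro_zero_morphisms))).

Lemma pro_exact : exact_conflations pro_zero_morphisms.
Proof. by apply: proa_exact; apply: exact_conflations_base. Qed.

Lemma ind_exact : exact_conflations ind_zero_morphisms.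
Proof. by apply: op_exact; apply: proa_exact; apply: op_exact; apply: pro_exact. Qed.

Lemma pro_adm_mono_monic (X Y : K) (m : hom X Y) : adm_mono m -> monic m.
Proof. by move=> [c [p /pro_exact [/kernel_monic]]]. Qed.

(** An ind-object is a pro-object of the opposite category, so that the facts below
    are those on pro-objects read in [op K]. *)
Definition ind_map (X Y : K) (f : hom X Y) : hom (inda_of_proa X) (inda_of_proa Y) :=
  @pconst_map (op K) Y X f.

Lemma ind_map_heq (X Y : K) (f g : hom X Y) : f ≈ g -> ind_map f ≈ ind_map g.
Proof. exact: (@pconst_map_heq (op K)). Qed.

#[export] Instance ind_map_Proper (X Y : K) : Proper (heq ==> heq) (@ind_map X Y).
Proof. by move=> f g; apply: ind_map_heq. Qed.

Lemma ind_map_comp (X Y V : K) (g : hom Y V) (f : hom X Y) :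
  ind_map (g ∘ f) ≈ ind_map g ∘ ind_map f.
Proof. exact: (@pconst_map_comp (op K)). Qed.

Lemma ind_map_id (X : K) : ind_map (idm X) ≈ idm (inda_of_proa X).
Proof. exact: (@pconst_map_id (op K)). Qed.

Lemma ind_map_full (X Y : K) (f : hom (inda_of_proa X) (inda_of_proa Y)) :
  exists u : hom X Y, f ≈ ind_map u.
Proof. exact: (@pconst_full (op K)). Qed.

Lemma ind_map_faithful (X Y : K) (f g : hom X Y) : ind_map f ≈ ind_map g -> f ≈ g.
Proof. exact: (@pconst_faithful (op K)). Qed.

Lemma inda_of_proa_isomorphic (X Y : K) :
  isomorphic (inda_of_proa X) (inda_of_proa Y) -> isomorphic X Y.
Proof.
move=> [f [g [gf fg]]]; have [u eu] := ind_map_full f; have [v ev] := ind_map_full g.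
exists u, v; split; apply: ind_map_faithful.
  by rewrite ind_map_comp -eu -ev gf ind_map_id.
by rewrite ind_map_comp -eu -ev fg ind_map_id.
Qed.

Lemma const_proa_isomorphic (a b : A) :
  isomorphic (const_proa a) (const_proa b) -> isomorphic a b.
Proof.
move=> [f [g [gf fg]]]; have [u eu] := pconst_full f; have [v ev] := pconst_full g.
exists u, v; split; apply: pconst_faithful.
  by rewrite pconst_map_comp -eu -ev pconst_map_id; exact: gf.
by rewrite pconst_map_comp -eu -ev pconst_map_id; exact: fg.
Qed.

Section Incl.
Variable V : W.
Notation J := (pidx (sval V)).

Definition ind_term (j : J) : K := psys (sval V) j.

Definition ind_trans (i j : J) (l : dle i j) : hom (ind_term i) (ind_term j) :=
  smap (psys (sval V)) l.

Definition ind_incl (j : J) : hom (inda_of_proa (ind_term j)) V :=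
  @pproj (op K) (sval V) j.

Lemma ind_trans_monic (i j : J) (l : dle i j) : monic (ind_trans l).
Proof. by apply: pro_adm_mono_monic; apply: (svalP V). Qed.

Lemma ind_factor (X : K) (f : hom (inda_of_proa X) V) :
  exists j (u : hom X (ind_term j)), f ≈ ind_incl j ∘ ind_map u.
Proof. exact: (@pproj_factor (op K)). Qed.

Lemma ind_incl_trans (i j : J) (l : dle i j) :
  ind_incl j ∘ ind_map (ind_trans l) ≈ ind_incl i.
Proof. exact: (@pproj_smap (op K)). Qed.

(** The transition maps are monic, so nothing is identified in the colimit. *)
Lemma ind_incl_faithful (X : K) j (u v : hom X (ind_term j)) :
  ind_incl j ∘ ind_map u ≈ ind_incl j ∘ ind_map v -> u ≈ v.
Proof.
move=> /(@pproj_eq_raise (op K) (sval V)) [m [jm e]].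
exact: (ind_trans_monic e).
Qed.

Lemma ind_incl_zero (X : K) j (u : hom X (ind_term j)) :
  ind_incl j ∘ ind_map u ≈ zmor ind_zero_morphisms _ _ ->
  u ≈ zmor pro_zero_morphisms _ _.
Proof.
move=> /(@pproj_zeroP (op K) (zero_op pro_zero_morphisms) (sval V)) [m [jm e]].
apply: (ind_trans_monic (l := jm)).
exact: (transitivity e (symmetry (zmor_r pro_zero_morphisms _ (ind_trans jm)))).
Qed.

Lemma ind_ext (V' : W) (f g : hom V V') :
  (forall j, f ∘ ind_incl j ≈ g ∘ ind_incl j) -> f ≈ g.
Proof. by move=> e; apply: (@pro_ext (op K) (sval V') (sval V)) => j; exact: e. Qed.

End Incl.

Lemma ind_map_zero (X Y : K) :
  ind_map (zmor pro_zero_morphisms X Y) ≈ zmor ind_zero_morphisms _ _.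
Proof. exact: (@pconst_zero (op K) (zero_op pro_zero_morphisms)). Qed.

Lemma ind_map_conflation (X Y V : K) (f : hom X Y) (g : hom Y V) :
  conflation f g -> conflation (ind_map f) (ind_map g).
Proof. by move=> fg; apply: (@proa_const_conflation (conflation_op K)). Qed.

Lemma ind_conflation_iso (X Y V X' Y' V' : W) (f : hom X Y) (g : hom Y V)
    (f' : hom X' Y') (g' : hom Y' V') :
  iso_seq f g f' g' -> conflation f g -> conflation f' g'.
Proof. by move=> /iso_seq_op; apply: (@proa_conflation_iso (conflation_op K)). Qed.

Lemma const_proa_map_heq (a b : A) (f g : hom a b) :
  f ≈ g -> const_proa_map f ≈ const_proa_map g.
Proof. exact: pconst_map_heq. Qed.

#[export] Instance const_proa_map_Proper (a b : A) :
  Proper (heq ==> heq) (@const_proa_map A a b).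
Proof. by move=> f g; apply: pconst_map_heq. Qed.

Lemma const_proa_map_comp (a b c : A) (g : hom b c) (f : hom a b) :
  const_proa_map (g ∘ f) ≈ const_proa_map g ∘ const_proa_map f.
Proof. exact: pconst_map_comp. Qed.

Lemma const_proa_map_id (a : A) : const_proa_map (idm a) ≈ idm (const_proa a).
Proof. exact: pconst_map_id. Qed.

Lemma const_proa_pullback (a b c p : A) (f : hom a c) (g : hom b c)
    (f' : hom p a) (g' : hom p b) : is_pullback f g f' g' ->
  is_pullback (const_proa_map f) (const_proa_map g) (const_proa_map f') (const_proa_map g').
Proof. by move=> /pconst_pullback pb; apply: full_pullback. Qed.

Lemma const_proa_monic (a b : A) (m : hom a b) :
  adm_mono m -> monic (const_proa_map m).
Proof. by move=> /const_proa_map_mono /pro_adm_mono_monic. Qed.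

(** * Rows of a double system *)

Variable D : double_system A.

Definition row_proj (j : int) (p : row_index j) :
    hom (row D j) (const_proa (D (val p))) :=
  @pproj A (Proob (row_system D j)) p.

Lemma row_proj_lower (j : int) (p q : row_index j) (l : zpair_le (val q) (val p)) :
  const_proa_map (dmap D l) ∘ row_proj q ≈ row_proj p.
Proof. exact: (@pproj_smap A (Proob (row_system D j)) p q l). Qed.

Lemma row_proj_deflation (j : int) (p : row_index j) :
  @pro_deflation A (sval (row D j)) _ (row_proj p).
Proof.
exists p, (idm _); split; first exact: adm_epi_id.
by rewrite pconst_map_id comp_idl.
Qed.

(** The definition of [row_map] uses one representative of this germ; any index below
    [q] gives the same one. *)
Lemma row_proj_map (j j' : int) (l : (j <= j')%R) (p : row_index j)
    (q : row_index j') (h : zpair_le (val p) (val q)) :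
  row_proj q ∘ row_map D l ≈ const_proa_map (dmap D h) ∘ row_proj p.
Proof.
transitivity (const_proa_map (dmap D (lower_le l q)) ∘ row_proj (lower j (val q))).
  move=> t; exists (lower j (val q)), (dle_refl _), (dle_refl _) => /=.
  by rewrite comp_idl comp_idr.
apply/(@pproj_eqP A (Proob (row_system D j))).
have [m [m1 m2]] := dle_directed (lower j (val q)) p.
exists m, m1, m2; rewrite /= !(dmap_comp D _ _ (zpair_le_trans m2 h)).
reflexivity.
Qed.

Lemma row_ext (X : K) (j : int) (f g : hom X (row D j)) :
  (forall p, row_proj p ∘ f ≈ row_proj p ∘ g) -> f ≈ g.
Proof. exact: (@pro_ext A (sval X) (Proob (row_system D j))). Qed.

Lemma row_map_monic (j j' : int) (l : (j <= j')%R) : monic (row_map D l).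
Proof. by apply: pro_adm_mono_monic; apply: row_map_mono. Qed.

Lemma row_lim (X : K) (j : int)
    (R : forall p : row_index j, hom X (const_proa (D (val p))) -> Prop) :
  (forall p, exists h, R p h) ->
  (forall p q (l : zpair_le (val q) (val p)) h h', R p h -> R q h' ->
    h ≈ const_proa_map (dmap D l) ∘ h') ->
  exists f : hom X (row D j), forall p, exists2 h, R p h & row_proj p ∘ f ≈ h.
Proof. exact: (@pro_lim A (sval X) (Proob (row_system D j))). Qed.

(** By cartesianness of the squares, [X_(i,j)] is the part of [X_(i,j')] on which
    the image in any fixed [X_(i0,j')] lies in [X_(i0,j)]. *)
Lemma row_pullback (j j' : int) (l : (j <= j')%R) (p : row_index j) :
  is_pullback (row_proj (raise l p)) (const_proa_map (dmap D (raise_ge l p)))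
    (row_map D l) (row_proj p).
Proof.
split; first exact: row_proj_map.
move=> T t v e.
have mono q : monic (const_proa_map (dmap D (raise_ge l q))).
  by apply: const_proa_monic; apply: dmap_mono.
have dmapE q r (qr : zpair_le (val r) (val q))
    (qr' : zpair_le (val (raise l r)) (val (raise l q))) :
    const_proa_map (dmap D (raise_ge l q)) ∘ const_proa_map (dmap D qr) ≈
    const_proa_map (dmap D qr') ∘ const_proa_map (dmap D (raise_ge l r)).
  rewrite -!const_proa_map_comp (dmap_comp D _ _ (zpair_le_trans qr (raise_ge l q))).
  by rewrite (dmap_comp D _ _ (zpair_le_trans qr (raise_ge l q))).
(* The component at [q] is determined by its image in the raised term; it is found at
   an index below both [q] and [p], where the square over [p] is cartesian. *)
pose R q (h : hom T (const_proa (D (val q)))) :=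
  const_proa_map (dmap D (raise_ge l q)) ∘ h ≈ row_proj (raise l q) ∘ t.
have ex q : exists h, R q h.
  have [r [rp rq]] := dle_directed p q.
  have rq' : zpair_le (val (raise l r)) (val (raise l q)) by split=> //; case: rq.
  have rp' : zpair_le (val (raise l r)) (val (raise l p)) by split=> //; case: rp.
  have sq : is_pullback (dmap D rp') (dmap D (raise_ge l p))
      (dmap D (raise_ge l r)) (dmap D rp).
    apply: dmap_cartesian => //.
    by rewrite (eqP (valP r)) (eqP (valP p)).
  have [|h [h1 _ _]] := (const_proa_pullback sq).2 T (row_proj (raise l r) ∘ t) v.
    by rewrite comp_assoc row_proj_lower.
  exists (const_proa_map (dmap D rq) ∘ h); rewrite /R comp_assoc.
  by rewrite (dmapE _ _ _ rq') -comp_assoc h1 comp_assoc row_proj_lower.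
have [|w hw] := row_lim ex.
  rewrite /R => q r qr h h' e1 e2; apply: mono; rewrite e1 comp_assoc.
  have qr' : zpair_le (val (raise l r)) (val (raise l q)) by split=> //; case: qr.
  by rewrite (dmapE _ _ _ qr') -comp_assoc e2 comp_assoc row_proj_lower.
have wt : row_map D l ∘ w ≈ t.
  apply: row_ext => q.
  have [h h1 h2] := hw (lower j (val q)); rewrite /R in h1.
  rewrite comp_assoc (row_proj_map l (lower_le l q)) -comp_assoc h2.
  rewrite -(row_proj_lower (lower_raise l q)) -comp_assoc -h1 comp_assoc.
  rewrite -const_proa_map_comp.
  by rewrite (dmap_comp D _ _ (lower_le l q)).
exists w; split=> //.
  by have [h h1 h2] := hw p; rewrite /R in h1; apply: mono; rewrite h2 h1.
by move=> w' e1 _; apply: (row_map_monic (l := l)); rewrite e1 wt.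
Qed.

End IndPro.

(** * Lattices in a double limit *)

Section Lattices.
Variables (A : exact_category) (D : double_system A).
Notation K := (proa A).
Notation W := (inda (proa A)).
Notation X := (double_limit D).
Notation ZK := (pro_zero_morphisms A).
Notation ZW := (ind_zero_morphisms A).

Definition row_incl (j : int) : hom (inda_of_proa (row D j)) X :=
  @ind_incl A X j.

Lemma row_incl_map (j j' : int) (l : (j <= j')%R) :
  row_incl j' ∘ ind_map (row_map D l) ≈ row_incl j.
Proof. exact: (@ind_incl_trans A X j j' l). Qed.

Lemma row_incl_faithful (T : K) j (u v : hom T (row D j)) :
  row_incl j ∘ ind_map u ≈ row_incl j ∘ ind_map v -> u ≈ v.
Proof. exact: (@ind_incl_faithful A X). Qed.

(** [U] is the part of the row [j] lying over the subobject [i] of [X_(i,j)]. *)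
Definition lattice_at (U : W) (phi : hom U X) (j : int) (p : row_index j) (n : A)
    (i : hom n (D (val p))) :=
  exists (Y : K) (w : hom (inda_of_proa Y) U) (f : hom Y (row D j))
    (g : hom Y (const_proa n)),
  [/\ is_iso w, phi ∘ w ≈ row_incl j ∘ ind_map f
    & is_pullback (row_proj D p) (const_proa_map i) f g].

Lemma lattice_iso (U V : W) (phi : hom U X) (psi : hom V X) (m : hom V U)
    (j : int) (p : row_index j) n (i : hom n (D (val p))) :
  is_iso m -> phi ∘ m ≈ psi -> lattice_at phi i -> lattice_at psi i.
Proof.
move=> [m' [m'm mm']] e [Y [w [f [g [hw ew pb]]]]]; exists Y, (m' ∘ w), f, g; split=> //.
  by apply: iso_comp => //; exists m.
by rewrite -e -comp_assoc (comp_assoc m) mm' comp_idl.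
Qed.

Lemma lattice_row (j : int) (p : row_index j) : lattice_at (row_incl j) (idm (D (val p))).
Proof.
exists (row D j), (idm _), (idm _), (row_proj D p); split; first exact: iso_idm.
  by rewrite comp_idr ind_map_id comp_idr.
split; first by rewrite const_proa_map_id comp_idl comp_idr.
move=> T u v; rewrite const_proa_map_id comp_idl => e.
exists u; split; rewrite ?comp_idl // => w.
by rewrite comp_idl.
Qed.

Lemma lattice_raise (U : W) (phi : hom U X) (j j' : int) (l : (j <= j')%R)
    (p : row_index j) n (i : hom n (D (val p))) :
  lattice_at phi i -> lattice_at (p := raise l p) phi (dmap D (raise_ge l p) ∘ i).
Proof.
move=> [Y [w [f [g [hw e pb]]]]]; exists Y, w, (row_map D l ∘ f), g; split=> //.
  by rewrite ind_map_comp comp_assoc row_incl_map.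
have := pullback_paste (pullback_swap (row_pullback D l p)) (pullback_swap pb).
by move/pullback_swap; apply: pullback_heq => //; rewrite const_proa_map_comp.
Qed.

Lemma lattice_lower (U : W) (phi : hom U X) (j : int) (p q : row_index j)
    (l : zpair_le (val q) (val p)) n n' (i : hom n (D (val p))) (i' : hom n' (D (val q)))
    (r : hom n' n) :
  is_pullback (dmap D l) i i' r -> lattice_at phi i -> lattice_at phi i'.
Proof.
move=> /const_proa_pullback pb' [Y [w [f [g [hw e pb]]]]].
have [|g' [g1 g2 _]] := pb'.2 _ (row_proj D q ∘ f) g.
  by rewrite comp_assoc (@row_proj_lower A D) pb.1.
exists Y, w, f, g'; split=> //.
apply: pullback_cancel pb' _ _; first by symmetry.
apply: pullback_heq pb => //; last by symmetry.
by symmetry; apply: (@row_proj_lower A D).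
Qed.

Lemma const_proa_kernel (a b c : A) (i : hom a b) (p : hom b c) :
  kernel_of (zero_of (exact_additive (exact_axioms A))) p i ->
  kernel_of ZK (const_proa_map p) (const_proa_map i).
Proof.
move=> ker; have [e un] := pro_kernel (m := const_system_hom point i)
  (p := const_system_hom point p) (fun _ => ker).
by split=> // T f /un.
Qed.

(** [U -> X] factors through some row, and the composite of that row with [X -> Q]
    factors through a map [h] between objects of the base category; [U] is the part
    of the row that maps into the kernel of [h]. *)
Lemma lattice_exists (hA : AIC A) (U Q : W) (phi : hom U X) (rho : hom X Q)
    (Y : K) (Z : inda A) :
  conflation phi rho -> isomorphic U (inda_of_proa Y) -> isomorphic Q (inda_of_inda Z) ->
  exists j (p : row_index j) n (i : hom n (D (val p))), adm_mono i /\ lattice_at phi i.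
Proof.
move=> /ind_exact [ker _] /isomorphic_sym [w hw] [z hz].
have phi_monic := kernel_monic ker.
have [j [f ef]] := ind_factor (phi ∘ w : hom (inda_of_proa Y) X).
change (hom Y (row D j)) in f; change (phi ∘ w ≈ row_incl j ∘ ind_map f) in ef.
pose V : W := inda_of_inda Z.
have [k [u eu]] := @ind_factor A V (row D j) (z ∘ rho ∘ row_incl j).
have [p [h eh]] : exists (p : row_index j) (h : hom (D (val p)) (psys (sval Z) k)),
    u ≈ (const_proa_map h ∘ row_proj D p : hom (row D j) (const_proa (psys (sval Z) k))).
  exact: (@pproj_factor A (Proob (row_system D j)) _ u).
have [n [i [ker_h hi]]] := AIC_kernel hA h.
have [hi0 ker_ch] := const_proa_kernel ker_h.
have zeroP (T : K) (t : hom T (row D j)) :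
    u ∘ t ≈ zmor ZK _ _ <-> rho ∘ (row_incl j ∘ ind_map t) ≈ zmor ZW _ _.
  have e : z ∘ (rho ∘ (row_incl j ∘ ind_map t)) ≈ @ind_incl A V k ∘ ind_map (u ∘ t).
    by rewrite ind_map_comp !comp_assoc eu.
  split=> ht.
    apply: (iso_monic hz); rewrite e ht ind_map_zero (zmor_r ZW).
    by symmetry; apply: (zmor_r ZW).
  apply: (@ind_incl_zero A V T k); rewrite -e ht; exact: (zmor_r ZW).
have uf0 : u ∘ f ≈ zmor ZK _ _.
  by apply/zeroP; rewrite -ef comp_assoc ker.1; apply: (zmor_l ZW).
have [g gi _] : exists2 g, const_proa_map i ∘ g ≈ row_proj D p ∘ f &
    forall g', const_proa_map i ∘ g' ≈ row_proj D p ∘ f -> g' ≈ g.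
  by apply: ker_ch; rewrite comp_assoc -uf0 eh.
have f_monic : monic f.
  move=> T a b ab; apply: ind_map_faithful; apply: (iso_monic hw); apply: phi_monic.
  by rewrite !comp_assoc ef -!comp_assoc -!ind_map_comp ab.
exists j, p, n, i; split=> //; exists Y, w, f, g; split=> //.
split; first by symmetry.
move=> T t v e; have [s es _] : exists2 s, phi ∘ s ≈ row_incl j ∘ ind_map t &
    forall s', phi ∘ s' ≈ row_incl j ∘ ind_map t -> s' ≈ s.
  apply: ker.2; apply/zeroP.
  by rewrite eh -comp_assoc e comp_assoc hi0; apply: zmor_l.
have [w' [w'w ww']] := hw; have [y ey] := ind_map_full (w' ∘ s).
have fy : f ∘ y ≈ t.
  apply: row_incl_faithful; rewrite ind_map_comp comp_assoc -ef -ey.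
  by rewrite -comp_assoc (comp_assoc w) ww' comp_idl.
exists y; split=> //.
  apply: (const_proa_monic hi); by rewrite comp_assoc gi -comp_assoc fy.
by move=> y' fy' _; apply: f_monic; rewrite fy fy'.
Qed.

Section Comparison.
Variables (U V : W) (phi : hom U X) (psi : hom V X) (m : hom U V).
Hypothesis psi_m : psi ∘ m ≈ phi.
Variables (j : int) (p : row_index j) (n n' : A).
Variables (i : hom n (D (val p))) (i' : hom n' (D (val p))).
Hypotheses (hi : adm_mono i) (hi' : adm_mono i').
Hypotheses (lat_U : lattice_at phi i) (lat_V : lattice_at psi i').

Lemma lattice_lift (Y Y' : K) (w : hom (inda_of_proa Y) U) (w' : hom (inda_of_proa Y') V)
    (f : hom Y (row D j)) (f' : hom Y' (row D j)) :
  is_iso w' -> phi ∘ w ≈ row_incl j ∘ ind_map f ->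
  psi ∘ w' ≈ row_incl j ∘ ind_map f' ->
  exists mu : hom Y Y', w' ∘ ind_map mu ≈ m ∘ w /\ f' ∘ mu ≈ f.
Proof.
move=> [v [_ w'v]] ew ew'; have [mu emu] := ind_map_full (v ∘ m ∘ w).
have wmu : w' ∘ ind_map mu ≈ m ∘ w.
  by rewrite -emu !comp_assoc w'v comp_idl.
exists mu; split=> //; apply: row_incl_faithful.
by rewrite ind_map_comp comp_assoc -ew' -ew -comp_assoc wmu comp_assoc psi_m.
Qed.

(** The subobject [n] can be recovered from [U] since [U -> n] is a deflation: a map
    out of [n] that vanishes on [U] is zero. *)
Lemma lattice_le : exists s : hom n n', i' ∘ s ≈ i.
Proof.
have [Y [w [f [g [hw ew pb]]]]] := lat_U.
have [Y' [w' [f' [g' [hw' ew' pb']]]]] := lat_V.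
have [mu [emu fmu]] := lattice_lift hw' ew ew'.
have [c [e ie]] := hi; have [c' [e' ie']] := hi'.
have [P [fP [gP [pbP _ dP]]]] := deflation_pullback (row_proj_deflation D p) ie.
have [a [_ fa ga]] := pullback_unique pb pbP.
have [ker_e' _] := exact_conflations_base ie'.
have e0 : const_proa_map (e' ∘ i) ∘ gP ≈
    const_proa_map (zmor (zero_of (exact_additive (exact_axioms A))) n c') ∘ gP.
  rewrite const_proa_map_comp -comp_assoc -pbP.1 -fa -fmu.
  rewrite !comp_assoc -(comp_assoc _ (row_proj D p)) pb'.1 comp_assoc -const_proa_map_comp ker_e'.1.
  transitivity (zmor ZK P (const_proa c')).
    rewrite -!comp_assoc -(zmor_l ZK _ (g' ∘ (mu ∘ a))).
    apply: comp_heq; last reflexivity; exact: pconst_zero.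
  symmetry; rewrite -(zmor_l ZK _ gP).
  apply: comp_heq; last reflexivity; exact: pconst_zero.
have ei0 := pro_deflation_epic dP e0.
by have [s es _] := ker_e'.2 _ _ ei0; exists s.
Qed.

(** [V] is a deflation over [n'], and [U] is the part of it that lies over [n]. *)
Lemma lattice_conflation (b : A) (s : hom n n') (c : hom n' b) :
  i' ∘ s ≈ i -> conflation s c -> exists r : hom V (inda_of_base b), conflation m r.
Proof.
move=> es sc.
have [Y [w [f [g [hw ew pb]]]]] := lat_U.
have [Y' [w' [f' [g' [hw' ew' pb']]]]] := lat_V.
have [mu [emu fmu]] := lattice_lift hw' ew ew'.
have [e' [c' ie']] := hi'.
have [P' [fP' [gP' [pbP' _ dP']]]] := deflation_pullback (row_proj_deflation D p) ie'.
have [P [fP [gP [pbP cP _]]]] := deflation_pullback dP' sc.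
have pbP1 : is_pullback (row_proj D p) (const_proa_map i) (fP' ∘ fP) gP.
  have := pullback_paste (pullback_swap pbP') (pullback_swap pbP).
  by move/pullback_swap; apply: pullback_heq => //; rewrite -const_proa_map_comp es.
have [a [ha fa _]] := pullback_unique pb pbP1.
have [a' [ha' fa' _]] := pullback_unique pb' pbP'.
have [[d [da' a'd]] [v [vw' w'v]]] := (ha', hw').
have cmu : conflation mu (const_proa_map c ∘ gP' ∘ d).
  apply: proa_conflation_iso cP; exists a, a', (idm _); split=> //; first exact: iso_idm.
    apply: (pullback_monic pb' (const_proa_monic hi')).
    by rewrite !comp_assoc fa' fmu fa.
  by rewrite comp_idl -comp_assoc da' comp_idr.
exists (ind_map (const_proa_map c ∘ gP' ∘ d) ∘ v).
apply: ind_conflation_iso (ind_map_conflation cmu).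
exists w, w', (idm _); split=> //; first exact: iso_idm.
by rewrite comp_idl -(comp_assoc _ v) vw' comp_idr.
Qed.

End Comparison.

End Lattices.

(** * Pro-objects and ind-objects as double limits *)

Section IndColimit.
Variable A : exact_category.
Notation W := (inda (proa A)).

Lemma ind_colim (V V' : W)
    (R : forall j, hom (inda_of_proa (@ind_term A V j)) V' -> Prop) :
  (forall j, exists h, R j h) ->
  (forall i j (l : dle i j) h h', R i h -> R j h' ->
    h ≈ h' ∘ ind_map (@ind_trans A V i j l)) ->
  exists f : hom V V', forall j, exists2 h, R j h & f ∘ @ind_incl A V j ≈ h.
Proof. exact: (@pro_lim (op (proa A)) (sval V') (sval V) R). Qed.

End IndColimit.

Section RowTransform.
Variables (A : exact_category) (D D' : double_system A).
Variable rel : zpair -> zpair -> Prop.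
Variable t : forall p q, rel p q -> hom (D p) (D' q).
Hypothesis t_pre : forall p p' q (l : zpair_le p' p) (h : rel p q) (h' : rel p' q),
  t h ∘ dmap D l ≈ t h'.
Hypothesis t_post : forall p q q' (l : zpair_le q q') (h : rel p q) (h' : rel p q'),
  dmap D' l ∘ t h ≈ t h'.
Hypothesis rel_pre : forall p p' q, zpair_le p' p -> rel p q -> rel p' q.

(** Two indices related to the same [q] give the same germ, as they have a common
    lower bound; so composites of such maps can be computed at any related indices. *)
Lemma row_transform (j j' : int) :
  (forall q : row_index j', exists p : row_index j, rel (val p) (val q)) ->
  exists f : hom (row D j) (row D' j'),
    forall (p : row_index j) (q : row_index j') (h : rel (val p) (val q)),
      row_proj D' q ∘ f ≈ const_proa_map (t h) ∘ row_proj D p.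
Proof.
move=> ex.
have indep (p p' : row_index j) q (h : rel (val p) q) (h' : rel (val p') q) :
    const_proa_map (t h) ∘ row_proj D p ≈ const_proa_map (t h') ∘ row_proj D p'.
  have [r [rp rp']] := dle_directed p p'.
  rewrite -(@row_proj_lower A D _ _ _ rp) -(@row_proj_lower A D _ _ _ rp') !comp_assoc.
  rewrite -!const_proa_map_comp (t_pre rp h (rel_pre rp h)).
  by rewrite (t_pre rp' h' (rel_pre rp h)).
pose R (q : row_index j') (g : hom (row D j) (const_proa (D' (val q)))) :=
  exists (p : row_index j) (h : rel (val p) (val q)), g ≈ const_proa_map (t h) ∘ row_proj D p.
have [|q q' l g g' [p [h e]] [p' [h' e']]|f hf] := @row_lim A D' (row D j) j' R.
- move=> q; have [p h] := ex q.
  by exists (const_proa_map (t h) ∘ row_proj D p), p, h.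
- have [r [rp rp']] := dle_directed p p'.
  have hr := rel_pre rp h; have hr' := rel_pre rp' h'.
  rewrite e e' (indep _ _ _ h hr) (indep _ _ _ h' hr') comp_assoc.
  by rewrite -const_proa_map_comp (t_post l hr' hr).
exists f => p q h; have [g [p' [h' e]] fg] := hf q.
by rewrite fg e; apply: indep.
Qed.

End RowTransform.

Section Truncation.
Variables (A : exact_category) (D : double_system A) (j : int).

Lemma cap_subproof (p : zpair) : (Order.min (lo p) j <= Order.min (hi p) j)%R.
Proof. by rewrite le_min ge_min lo_le_hi ge_min lexx orbT. Qed.

(** The system [X_(min(i,j),min(k,j))], indexed by the pairs (i, k), has the row [j] of [D] as double limit, which
    makes the row an object of the Beilinson category. *)
Definition cap (p : zpair) : zpair :=
  Sub (Order.min (lo p) j, Order.min (hi p) j) (cap_subproof p).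

Lemma cap_mono p q : zpair_le p q -> zpair_le (cap p) (cap q).
Proof.
by move=> [h h']; split; rewrite /lo /hi /= le_min !ge_min lexx ?h ?h' ?orbT.
Qed.

Lemma cap_le p : zpair_le (cap p) p.
Proof. by split; rewrite /lo /hi /= ge_min lexx. Qed.

Lemma cap_ge p : (hi p <= j)%R -> zpair_le p (cap p).
Proof.
move=> h; have h' := le_trans (lo_le_hi p) h.
by split; rewrite /lo /hi /= le_min lexx ?h ?h'.
Qed.

Lemma lo_lower k (q : zpair) : (lo (val (lower k q)) <= lo q)%R.
Proof. by rewrite {1}/lo /= ge_min lexx. Qed.

Lemma cap_lower_le k (q : row_index j) : zpair_le (cap (val (lower k (val q)))) (val q).
Proof.
split; first exact: le_trans (cap_le _).1 (lo_lower _ _).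
by rewrite (eqP (valP q)) /hi /= ge_min lexx orbT.
Qed.

#[local] Obligation Tactic := idtac.
Program Definition truncation : double_system A :=
  {| dob := fun p => D (cap p); dmap := fun p q l => dmap D (cap_mono l) |}.
Next Obligation. by move=> p l; apply: dmap_id. Qed.
Next Obligation. by move=> p q r l l' l''; apply: dmap_comp. Qed.
Next Obligation.
by move=> p q l h; apply: dmap_mono; rewrite /lo /= -/(lo p) -/(lo q) h.
Qed.
Next Obligation.
by move=> p q l h; apply: dmap_epi; rewrite /hi /= -/(hi p) -/(hi q) h.
Qed.
Next Obligation.
move=> p q r s pq pr qs rs h1 h2 h3 h4; apply: dmap_cartesian.
- by rewrite /lo /= -/(lo p) -/(lo q) h1.
- by rewrite /lo /= -/(lo r) -/(lo s) h2.
- by rewrite /hi /= -/(hi p) -/(hi r) h3.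
- by rewrite /hi /= -/(hi q) -/(hi s) h4.
Qed.

(** Beyond [j] the rows of the truncation are isomorphic to the row [j] of [D]; all
    the maps and their composites are given by maps of [D]. *)
Lemma row_beilinson : is_beilinson (inda_of_proa (row D j)).
Proof.
exists truncation.
have dE p q r (l : zpair_le p q) (l' : zpair_le q r) (l'' : zpair_le p r) :
  dmap D l' ∘ dmap D l ≈ dmap D l'' by apply: dmap_comp.
have [||||a ha] := @row_transform A D truncation (fun p q => zpair_le p (cap q))
    (fun p q h => dmap D h) _ _ _ j j.
- by move=> *; apply: dE.
- by move=> *; apply: dE.
- by move=> p p' q; apply: zpair_le_trans.
- by move=> q; exists q; apply: cap_ge; rewrite (eqP (valP q)).
have exb : forall k, exists b : hom (row truncation k) (row D j),
    forall (p : row_index k) (q : row_index j) (h : zpair_le (cap (val p)) (val q)),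
      row_proj D q ∘ b ≈ const_proa_map (dmap D h) ∘ row_proj truncation p.
  move=> k; apply: (@row_transform A truncation D (fun p q => zpair_le (cap p) q)
    (fun p q h => dmap D h)).
  - by move=> *; apply: dE.
  - by move=> *; apply: dE.
  - by move=> p p' q l; apply: zpair_le_trans; apply: cap_mono.
  by move=> q; exists (lower k (val q)); apply: cap_lower_le.
have ab k b : (forall (p : row_index k) (q : row_index j) (h : zpair_le (cap (val p)) (val q)),
      row_proj D q ∘ b ≈ const_proa_map (dmap D h) ∘ row_proj truncation p) ->
    forall m (jm : (j <= m)%R) (km : (k <= m)%R),
      row_map truncation jm ∘ (a ∘ b) ≈ row_map truncation km.
  move=> hb m jm km; apply: row_ext => q.
  pose p := lower j (val q); pose r := lower k (val p).
  have rq : zpair_le (val r) (val q).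
    split; first exact: le_trans (lo_lower _ _) (lo_lower _ _).
    by rewrite (eqP (valP q)).
  have pp : zpair_le (val p) (cap (val p)) by apply: cap_ge; rewrite (eqP (valP p)).
  have rp : zpair_le (cap (val r)) (val p) := cap_lower_le k p.
  rewrite comp_assoc (@row_proj_map A truncation _ _ jm _ _ (lower_le jm q)) -comp_assoc.
  rewrite (comp_assoc _ a) (ha p p pp) -comp_assoc (hb r p rp).
  rewrite (@row_proj_map A truncation _ _ km _ _ rq).
  rewrite !comp_assoc -!const_proa_map_comp.
  apply: comp_heq => //; apply: const_proa_map_heq.
  rewrite (dE _ _ _ _ _ (zpair_le_trans pp (cap_mono (lower_le jm q)))).
  exact: dE.
pose R k (h : hom (inda_of_proa (row truncation k)) (inda_of_proa (row D j))) :=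
  exists2 b, h ≈ ind_map b &
  forall (p : row_index k) (q : row_index j) (h : zpair_le (cap (val p)) (val q)),
      row_proj D q ∘ b ≈ const_proa_map (dmap D h) ∘ row_proj truncation p.
have [||beta hbeta] := @ind_colim A (double_limit truncation) (inda_of_proa (row D j)) R.
- by move=> k; have [b hb] := exb k; exists (ind_map b), b.
- move=> k k' l h h' [b e hb] [b' e' hb']; rewrite e e'.
  rewrite -ind_map_comp; apply: ind_map_heq; apply: row_ext => q.
  pose p' := lower k' (val q); pose p := lower k (val p').
  have pp' : zpair_le (val p) (val p') by apply: lower_le.
  have p'q : zpair_le (cap (val p')) (val q) := cap_lower_le k' q.
  rewrite comp_assoc (hb' p' q p'q) -comp_assoc.
  change (@ind_trans A (double_limit truncation) k k' l) with (row_map truncation l).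
  rewrite (@row_proj_map A truncation _ _ l _ _ pp') (hb p q (zpair_le_trans (cap_mono pp') p'q)).
  by rewrite comp_assoc -const_proa_map_comp dE.
exists (row_incl truncation j ∘ ind_map a), beta; split.
  rewrite comp_assoc; have [h [b e hb] ->] := hbeta j.
  rewrite e -ind_map_comp -ind_map_id; apply: ind_map_heq; apply: row_ext => q.
  have qq : zpair_le (val q) (cap (val q)) by apply: cap_ge; rewrite (eqP (valP q)).
  rewrite comp_assoc (hb q q (cap_le (val q))) -comp_assoc (ha q q qq) comp_assoc.
  rewrite -const_proa_map_comp (dE _ _ _ _ _ (zpair_le_refl _)) dmap_id.
  by rewrite const_proa_map_id comp_idl comp_idr.
apply: ind_ext => k; rewrite -comp_assoc; have [h [b e hb] ->] := hbeta k.
have [m [jm km]] := dle_directed (j : int_index) k.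
rewrite e comp_idl -comp_assoc -ind_map_comp -(@row_incl_map A truncation _ _ jm).
by rewrite -comp_assoc -ind_map_comp (ab _ _ hb _ jm km) (@row_incl_map A truncation).
Qed.

End Truncation.

Section IndObjects.
Variables (A : exact_category) (E : system int_index (op A)).
Hypothesis hE : @admissible_system (conflation_op A) _ E.

Definition emap (k k' : int) (l : (k <= k')%R) : hom (E k : A) (E k') :=
  smap E (l : @dle int_index k k').

Lemma emap_comp k k' k'' (l : (k <= k')%R) (l' : (k' <= k'')%R) (l'' : (k <= k'')%R) :
  emap l' ∘ emap l ≈ emap l''.
Proof. exact: (smap_comp E). Qed.

Lemma emap_id k (l : (k <= k)%R) : emap l ≈ idm (E k : A).
Proof. exact: (smap_id E). Qed.

Lemma emap_iso k k' (l : (k <= k')%R) : k = k' -> is_iso (emap l).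
Proof.
move=> e; have l' : (k' <= k)%R by rewrite e.
by exists (emap l'); split; rewrite (emap_comp _ _ (lexx _)) emap_id.
Qed.

#[local] Obligation Tactic := idtac.
(** A system that is constant in the pro-direction: its rows are constant, and its
    double limit is the ind-object given by [E]. *)
Program Definition hi_system : double_system A :=
  {| dob := fun p => E (hi p) : A; dmap := fun p q l => emap l.2 |}.
Next Obligation. by move=> p l; apply: emap_id. Qed.
Next Obligation. by move=> p q r l l' l''; apply: emap_comp. Qed.
Next Obligation. by move=> p q l _; exact: (@hE _ _ l.2). Qed.
Next Obligation.
move=> p q l h.
apply: (adm_epi_iso (iso_idm (E (hi p) : A)) (emap_iso l.2 h)) (adm_epi_id (E (hi p) : A)).
by [].
Qed.
Next Obligation.
move=> p q r s pq pr qs rs _ _ h h'.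
have e1 := emap_comp pq.2 qs.2 (le_trans pq.2 qs.2).
have e2 := emap_comp pr.2 rs.2 (le_trans pq.2 qs.2).
split; first by rewrite e1 e2.
move=> T u v e; have [x [x1 x2]] := emap_iso pr.2 h.
have mono := iso_monic (emap_iso qs.2 h').
have xv : emap pr.2 ∘ (x ∘ v) ≈ v by rewrite comp_assoc x2 comp_idl.
exists (x ∘ v); split=> //.
  by apply: mono; rewrite e -[X in _ ≈ _ ∘ X]xv !comp_assoc e1 e2.
by move=> w _ e'; rewrite -e' comp_assoc x1 comp_idl.
Qed.

Lemma inda_of_inda_beilinson : is_beilinson (inda_of_inda (mk_proa hE : inda A)).
Proof.
exists hi_system; pose V := inda_of_inda (mk_proa hE : inda A).
have exa k : exists a : hom (const_proa (E k : A)) (row hi_system k),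
    forall (q : row_index k) (l : (k <= hi (val q))%R),
      row_proj hi_system q ∘ a ≈ const_proa_map (emap l).
  pose R (q : row_index k) (h : hom (const_proa (E k : A)) (const_proa (hi_system (val q)))) :=
    exists l : (k <= hi (val q))%R, h ≈ const_proa_map (emap l).
  have [q|q q' l h h' [l1 e] [l2 e']|a ha] :=
    @row_lim A hi_system (const_proa (E k : A)) k R.
  - have l : (k <= hi (val q))%R by rewrite (eqP (valP q)).
    by exists (const_proa_map (emap l)), l.
  - rewrite e e' -const_proa_map_comp; apply: const_proa_map_heq.
    by symmetry; apply: emap_comp.
  exists a => q l; have [h [l' e] ->] := ha q.
  by rewrite e (bool_irrelevance l l').
pose R k (h : hom (inda_of_proa (@ind_term A V k)) (double_limit hi_system)) :=
  exists2 a : hom (const_proa (E k : A)) (row hi_system k),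
    h ≈ row_incl hi_system k ∘ ind_map a &
  forall (q : row_index k) (l : (k <= hi (val q))%R),
      row_proj hi_system q ∘ a ≈ const_proa_map (emap l).
have [k|k k' l h h' [a e ha] [a' e' ha']|alpha halpha] := @ind_colim A V _ R.
- by have [a ha] := exa k; exists (row_incl hi_system k ∘ ind_map a), a.
- rewrite e e' -(@row_incl_map A hi_system _ _ l) -!comp_assoc -!ind_map_comp.
  apply: comp_heq => //; apply: ind_map_heq; apply: row_ext => q.
  have l1 : (k <= hi (val (lower k (val q))))%R by [].
  have l2 : (k' <= hi (val q))%R by rewrite (eqP (valP q)).
  rewrite !(comp_assoc (row_proj hi_system q)).
  rewrite (@row_proj_map A hi_system _ _ l _ _ (lower_le l q)).
  rewrite -comp_assoc (ha _ l1) (ha' _ l2).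
  transitivity (const_proa_map (emap (lower_le l q).2) ∘ const_proa_map (emap l1)) => //.
  transitivity (const_proa_map (emap l2) ∘ const_proa_map (emap l)) => //.
  rewrite -!const_proa_map_comp; apply: const_proa_map_heq.
  by rewrite !(emap_comp _ _ (le_trans l l2)).
pose o k : row_index k := exist _ (zdiag k) (eqxx k).
pose S k (h : hom (inda_of_proa (@ind_term A (double_limit hi_system) k)) V) :=
  h ≈ @ind_incl A V k ∘ ind_map (row_proj hi_system (o k)).
have [k|k k' l h h' e e'|beta hbeta] := @ind_colim A (double_limit hi_system) V S.
- by exists (@ind_incl A V k ∘ ind_map (row_proj hi_system (o k))); rewrite /S.
- rewrite /S in e e'; rewrite e e' -(@ind_incl_trans A V k k' l) -!comp_assoc -!ind_map_comp.
  apply: comp_heq => //; apply: ind_map_heq.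
  pose h1 : zpair_le (val (o k)) (val (o k')) := conj l l.
  symmetry; rewrite (@row_proj_map A hi_system _ _ l (o k) (o k') h1).
  by apply: comp_heq => //; apply: const_proa_map_heq; exact: (smap_irr E).
exists alpha, beta; split; apply: ind_ext => k; rewrite -comp_assoc comp_idl.
  have [h [a e ha] ->] := halpha k; have [h' e' hb] := hbeta k; rewrite /S in e'.
  change (beta ∘ row_incl hi_system k ≈ h') in hb.
  rewrite e comp_assoc hb e' -comp_assoc -ind_map_comp (ha (o k) (lexx k)).
  transitivity (@ind_incl A V k ∘ ind_map (idm (const_proa (E k : A)))); last first.
    by rewrite ind_map_id comp_idr.
  apply: comp_heq => //; apply: ind_map_heq.
  by rewrite emap_id const_proa_map_id.
have [h e ->] := hbeta k; rewrite /S in e; have [h' [a e' ha] ea] := halpha k.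
rewrite e comp_assoc ea e' -comp_assoc -ind_map_comp.
transitivity (row_incl hi_system k ∘ ind_map (idm (row hi_system k))); last first.
  by rewrite ind_map_id comp_idr.
apply: comp_heq => //; apply: ind_map_heq; apply: row_ext => q.
have l : (k <= hi (val q))%R by rewrite (eqP (valP q)).
have qo : zpair_le (val q) (val (o k)).
  by split; [apply: le_trans (lo_le_hi _) _|]; rewrite (eqP (valP q)).
rewrite comp_assoc (ha q l) comp_idr -(@row_proj_lower A hi_system _ _ _ qo) comp_assoc.
transitivity (const_proa_map (emap l) ∘ const_proa_map (emap qo.2) ∘
  row_proj hi_system q) => //.
by rewrite -const_proa_map_comp (emap_comp _ _ (lexx _)) emap_id const_proa_map_id comp_idl.
Qed.

End IndObjects.

Lemma is_beilinson_iso (A : exact_category) (U V : inda (proa A)) :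
  isomorphic U V -> is_beilinson V -> is_beilinson U.
Proof. by move=> h [D h']; exists D; apply: isomorphic_trans h h'. Qed.

Lemma inda_of_base_beilinson (A : exact_category) (a : A) : is_beilinson (inda_of_base a).
Proof.
pose E := @const_system int_index (op A) a.
have hE : @admissible_system (conflation_op A) _ E.
  move=> k k' l; have [z hz] := has_zero_object (exact_additive (exact_axioms A)).
  have [[f _] _] := hz a; exists z, f; exact: conflation_id_zero.
apply: is_beilinson_iso (inda_of_inda_beilinson hE).
pose V := inda_of_inda (mk_proa hE : inda A).
have transE (k k' : int_index) (l : dle k k') : @ind_trans A V k k' l ≈ idm (const_proa a).
  exact: const_proa_map_id.
have [k|k k' l h h' e e'|g hg] := @ind_colim A V (inda_of_base a)
  (fun k h => h ≈ idm (inda_of_base a)).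
- by exists (idm (inda_of_base a)).
- by rewrite e e' (transE _ _ l) comp_idl; symmetry; exact: ind_map_id.
pose i0 : hom (inda_of_base a) V := @ind_incl A V (0%R : int).
have inclE (k : int_index) : @ind_incl A V k ≈ i0.
  have [m [km om]] := dle_directed k (0%R : int).
  rewrite /i0 -(ind_incl_trans (V := V) km) -(ind_incl_trans (V := V) om).
  by apply: comp_heq => //; apply: ind_map_heq; rewrite !transE.
exists i0, g; split; first by have [h e e'] := hg (0%R : int); rewrite e'.
apply: ind_ext => k; have [h e e'] := hg k; rewrite -comp_assoc e' comp_idl inclE.
by rewrite e; exact: comp_idr.
Qed.

(** * Rows as members of the Sato Grassmannian *)

Section RowQuotient.
Variables (A : exact_category) (D : double_system A).
Notation K := (proa A).
Notation W := (inda (proa A)).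

(** The row [j] is the pullback of [X_(i,j)] in the row [j'], so that they have the
    same quotient. *)
Lemma row_map_conflation (j j' : int) (l : (j <= j')%R) (p : row_index j) (b : A)
    (e : hom (D (val (raise l p))) b) :
  conflation (dmap D (raise_ge l p)) e ->
  conflation (row_map D l) (const_proa_map e ∘ row_proj D (raise l p)).
Proof.
move=> de; have [Y [f [g [pb cf _]]]] :=
  deflation_pullback (row_proj_deflation D (raise l p)) de.
have [w [hw fw _]] := pullback_unique (row_pullback D l p) pb.
apply: proa_conflation_iso cf; exists w, (idm _), (idm _); split=> //.
- exact: iso_idm.
- exact: iso_idm.
- by rewrite comp_idl fw.
by rewrite comp_idl comp_idr.
Qed.

Variable j : int.
Let o : row_index j := exist _ (zdiag j) (eqxx j).
(** The quotient of [X] by the row [j] is the formal colimit of the quotients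
    [X_(j,k)/X_(j,j)] for [k >= j], reindexed by all integers through max(j, k). *)
Let top (k : int) : int := Order.max j k.
Let top_ge k : (j <= top k)%R.
Proof. by rewrite le_max lexx. Qed.
Let top_mono (k k' : int) : (k <= k')%R -> (top k <= top k')%R.
Proof. by move=> l; rewrite ge_max !le_max lexx l orbT. Qed.
Let d (k : int) : zpair := val (raise (top_ge k) o).
Let od k : zpair_le (val o) (d k) := raise_ge (top_ge k) o.
Let dd k k' (l : (k <= k')%R) : zpair_le (d k) (d k').
Proof. by split=> //; apply: top_mono. Qed.

Let data k : {b : A & {e : hom (D (d k)) b | conflation (dmap D (od k)) e}}.
Proof.
have /cid [b /cid [e h]] : adm_mono (dmap D (od k)) by apply: dmap_mono.
exists b; exact: (exist _ e h).
Qed.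
Let Q k : A := projT1 (data k).
Let e k : hom (D (d k)) (Q k) := sval (projT2 (data k)).
Let e_conf k : conflation (dmap D (od k)) (e k) := svalP (projT2 (data k)).
Let e_epi k : epic (e k).
Proof. by apply: adm_epi_epic; exists (D (val o)), (dmap D (od k)). Qed.

Let trans k k' (l : (k <= k')%R) :
  {s : hom (Q k) (Q k') | s ∘ e k ≈ e k' ∘ dmap D (dd l)}.
Proof.
apply: cid; have [_ [_ co]] := exact_conflations_base (e_conf k).
have [_ [z _]] := exact_conflations_base (e_conf k').
have [|s es _] := co _ (e k' ∘ dmap D (dd l)); last by exists s.
rewrite /= -comp_assoc (dmap_comp D _ _ (od k')); exact: z.
Qed.

#[local] Obligation Tactic := idtac.
Program Definition quotient_system : system int_index (op A) :=
  {| sob := Q; smap := fun k k' l => sval (trans l) |}.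
Next Obligation.
move=> k l; apply: e_epi; rewrite (svalP (trans l)) dmap_id comp_idr; symmetry.
exact: comp_idl.
Qed.
Next Obligation.
move=> k k' k'' l l' l''; apply: e_epi; rewrite /= -comp_assoc (svalP (trans l)).
rewrite comp_assoc (svalP (trans l')) -comp_assoc (dmap_comp D _ _ (dd l'')).
by symmetry; exact: (svalP (trans l'')).
Qed.

Lemma quotient_admissible : @admissible_system (conflation_op A) _ quotient_system.
Proof.
move=> k k' l; apply: (adm_mono_quotient (e_conf k) _ _ (svalP (trans l))).
  apply: (conflation_iso (exact_axioms A) _ (e_conf k')).
  exists (idm _), (idm _), (idm _); split; try exact: iso_idm.
    by rewrite comp_idl comp_idr (dmap_comp D _ _ (od k')).
  by rewrite comp_idl comp_idr.
exact: dmap_mono.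
Qed.

Let Y : inda A := mk_proa quotient_admissible.
Let T := @reindex (op K) int_index int_index (col_system D) top top_mono.

Let qmap k : hom (row D (top k)) (const_proa (Q k)) :=
  const_proa_map (e k) ∘ row_proj D (raise (top_ge k) o).

Program Definition row_quotient_hom : @system_hom int_index (op K) (const_proa_system Y) T :=
  {| shom := fun k => qmap k |}.
Next Obligation.
move=> k k' l.
change (const_proa_map (sval (trans l)) ∘ qmap k ≈ qmap k' ∘ row_map D (top_mono l)).
rewrite /qmap -comp_assoc.
rewrite (@row_proj_map A D _ _ (top_mono l) (raise (top_ge k) o) _ (dd l)) !comp_assoc.
by rewrite -!const_proa_map_comp (svalP (trans l)).
Qed.

Program Definition row_sub_hom :
    @system_hom int_index (op K) T (const_system int_index (row D j : op K)) :=
  {| shom := fun k => row_map D (top_ge k) |}.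
Next Obligation.
move=> k k' l.
change (row_map D (top_mono l) ∘ row_map D (top_ge k) ≈ row_map D (top_ge k') ∘ idm _).
rewrite comp_idr; exact: (smap_comp (col_system D) (top_ge k) (top_mono l) (top_ge k')).
Qed.

(** The levels are the conflations of [row_map_conflation]; the rows max(j, k) are
    cofinal in all rows. *)
Lemma row_incl_conflation : exists (E : system int_index (op A))
    (hE : @admissible_system (conflation_op A) _ E)
    (rho : hom (double_limit D) (inda_of_inda (mk_proa hE : inda A))),
  conflation (row_incl D j) rho.
Proof.
exists quotient_system, quotient_admissible.
have cofinal (k : int_index) : exists k' : int_index, @dle int_index k (top k').
  by exists k; rewrite /= /top le_max lexx orbT.
have [r' [r'r rr']] := @reindex_iso (op K) int_index int_index (col_system D) top top_mono cofinal.
set r := reindex_hom _ _ in r'r rr'.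
pose S0 := const_proa_system Y.
pose f : @hom (pro (op K)) (Proob S0) (Proob (col_system D)) :=
  r' ∘ formal_lim row_quotient_hom.
exists f.
have hT : @admissible_system (conflation_op K) _ T by move=> k k' l; exact: row_map_mono.
have hU : @admissible_system (conflation_op K) _ (const_system int_index (row D j : op K)).
  by move=> k k' l; exact: adm_mono_id_proa.
exists int_index, S0, T, (const_system int_index (row D j : op K)).
exists (@const_proa_system_admissible A Y), hT, hU, row_quotient_hom, row_sub_hom.
split; first by move=> k; exact: row_map_conflation (e_conf k).
pose k0 : int_index := (0%R : int).
pose t := @pproj (op K) (Proob (const_system int_index (row D j : op K))) k0.
have ht : @is_iso (pro (op K)) _ _ t by exact: const_proj_iso.
exists (idm _), r', t; split.
- exact: iso_idm.
- by exists r.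
- exact: ht.
- by symmetry; exact: (@comp_idr (pro (op K))).
change (t ∘ formal_lim row_sub_hom ≈ @pproj (op K) (Proob (col_system D)) j ∘ r').
rewrite /t formal_lim_proj.
have <- : @pproj (op K) (Proob (col_system D)) (top k0) ∘ r' ≈ @pproj (op K) (Proob T) k0.
  rewrite -(@reindex_homE (op K) int_index int_index (col_system D) top top_mono k0).
  by rewrite -comp_assoc rr' comp_idr.
rewrite comp_assoc; apply: comp_heq => //.
exact: (@pproj_smap (op K) (Proob (col_system D)) j (top k0) (top_ge k0)).
Qed.

End RowQuotient.

(** * Relative dimension *)

Section RelativeDimension.
Variables (A : exact_category) (hA : AIC A) (G : zmodType) (chi : A -> G).
Hypothesis hchi : dimensional_theory chi.
Variables (X : beilinson A) (D : double_system A).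
Notation W := (inda (proa A)).
Variable eps : hom (sval X : W) (double_limit D).
Variable eps' : hom (double_limit D) (sval X : W).
Hypothesis eps_inv : inverse_pair eps eps'.

Let eps_iso : is_iso eps.
Proof. by exists eps'. Qed.
Let eps'_iso : is_iso eps'.
Proof. exact: inverse_is_iso eps_inv. Qed.

Definition coord (U : subobject X) : hom (sval (sub_ob U) : W) (double_limit D) :=
  eps ∘ (incl U : hom (sval (sub_ob U) : W) (sval X)).

Lemma subobject_lattice (U : subobject X) :
  exists j (p : row_index j) n (i : hom n (D (val p))), adm_mono i /\ lattice_at (coord U) i.
Proof.
have [Q [q [Uq [Z hZ]]]] := sub_quotient U; have [Y hY] := sub_proa U.
apply: (lattice_exists hA (rho := (q : hom (sval X : W) (sval Q)) ∘ eps') _ hY hZ).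
apply: ind_conflation_iso Uq; exists (idm _), eps, (idm _); split=> //.
- exact: iso_idm.
- exact: iso_idm.
- by rewrite comp_idr.
by rewrite comp_idl -comp_assoc eps_inv.1; symmetry; exact: comp_idr.
Qed.

(** This is the index (k, 0) when [k <= 0]. *)
Definition corner (k : int) : zpair := val (lower 0%R (zdiag k)).

(** [n'] is the inverse image of [n] in [X_(i',j')].  The last claim holds because
    [n' -> n] and [X_(i',0) -> X_(i,0)] are both pullbacks of [X_(i',j') -> X_(i,j')]. *)
Lemma lattice_move (U : W) (phi : hom U (double_limit D)) (j j' : int)
    (p : row_index j) (q : row_index j') n (i : hom n (D (val p))) :
  (j <= j')%R -> (lo (val q) <= lo (val p))%R -> adm_mono i -> lattice_at phi i ->
  exists n' (i' : hom n' (D (val q))), [/\ adm_mono i', lattice_at phi i' &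
    (lo (val p) <= 0)%R -> (0 <= j)%R ->
    (chi n' - chi n = chi (D (corner (lo (val q)))) - chi (D (corner (lo (val p)))))%R].
Proof.
move=> l qp hi lat; have lat' := lattice_raise l lat.
set i1 := _ ∘ i in lat'.
have hi1 : adm_mono i1.
  by apply: adm_mono_comp => //; [exact: exact_axioms|exact: dmap_mono].
have qp' : zpair_le (val q) (val (raise l p)).
  by split=> //; rewrite (eqP (valP q)).
have he : adm_epi (dmap D qp') by apply: dmap_epi; rewrite (eqP (valP q)).
have [n' [i' [r [pb hr]]]] := adm_epi_pullback (exact_axioms A) i1 he.
have [b [e ie]] := hi1.
exists n', i'; split.
- by exists b, (e ∘ dmap D qp'); apply: pullback_conflation pb he ie.
- exact: lattice_lower pb lat'.
move=> p0 j0; rewrite (pullback_dimension hchi pb he).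
have q0 := le_trans qp p0.
have c1 : zpair_le (corner (lo (val q))) (val q).
  by split; rewrite /corner; [exact: lo_lower|rewrite (eqP (valP q)); exact: le_trans j0 l].
have c2 : zpair_le (corner (lo (val p))) (val (raise l p)).
  by split; [exact: lo_lower|exact: le_trans j0 l].
have loE k : (k <= 0)%R -> lo (corner k) = k by move=> k0; rewrite {1}/lo /= min_l.
have c3 : zpair_le (corner (lo (val q))) (corner (lo (val p))).
  by split=> //; rewrite !loE.
have sq : is_pullback (dmap D qp') (dmap D c2) (dmap D c1) (dmap D c3).
  apply: dmap_cartesian => //; try by rewrite loE.
  by rewrite (eqP (valP q)).
by symmetry; apply: (pullback_dimension hchi sq he).
Qed.

(** The dimension of [U] relative to the row [0]: when [U] is the part of the row
    [j] lying over [n] in [X_(k,j)], and [k <= 0 <= j], both contain the kernel of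
    the row [j] over [X_(k,j)], and the quotients by it are [n] and [X_(k,0)]. *)
Definition dimension_of (U : subobject X) (x : G) :=
  exists j (p : row_index j) n (i : hom n (D (val p))),
  [/\ adm_mono i, lattice_at (coord U) i, (lo (val p) <= 0)%R, (0 <= j)%R &
    x = (chi n - chi (D (corner (lo (val p)))))%R].

Lemma dimension_exists (U : subobject X) : exists x, dimension_of U x.
Proof.
have [j [p [n [i [hi lat]]]]] := subobject_lattice U.
pose j' := Order.max j 0%R; pose k := Order.min (lo (val p)) 0%R.
pose q := lower j' (zdiag k).
have qk : (lo (val q) <= k)%R := lo_lower _ _.
have jj' : (j <= j')%R by rewrite le_max lexx.
have qp : (lo (val q) <= lo (val p))%R by apply: le_trans qk _; rewrite ge_min lexx.
have [n' [i' [hi' lat' _]]] := lattice_move jj' qp hi lat.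
exists (chi n' - chi (D (corner (lo (val q)))))%R, j', q, n', i'; split=> //.
  by apply: le_trans qk _; rewrite ge_min lexx orbT.
by rewrite le_max lexx orbT.
Qed.

Lemma dimension_common (U V : subobject X) x y : dimension_of U x -> dimension_of V y ->
  exists j (p : row_index j) n n' (i : hom n (D (val p))) (i' : hom n' (D (val p))),
  [/\ adm_mono i, adm_mono i', lattice_at (coord U) i, lattice_at (coord V) i' &
    (y - x = chi n' - chi n)%R].
Proof.
move=> [j [p [n [i [hi lat p0 j0 ->]]]]] [j' [p' [n' [i' [hi' lat' p0' j0' ->]]]]].
pose J := Order.max j j'; pose k := Order.min (lo (val p)) (lo (val p')).
pose q := lower J (zdiag k).
have qk : (lo (val q) <= k)%R := lo_lower _ _.
have jJ : (j <= J)%R by rewrite le_max lexx.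
have jJ' : (j' <= J)%R by rewrite le_max lexx orbT.
have qp : (lo (val q) <= lo (val p))%R by apply: le_trans qk _; rewrite ge_min lexx.
have qp' : (lo (val q) <= lo (val p'))%R.
  by apply: le_trans qk _; rewrite ge_min lexx orbT.
have [m [a [ha lat_a e]]] := lattice_move jJ qp hi lat.
have [m' [a' [ha' lat_a' e']]] := lattice_move jJ' qp' hi' lat'.
exists J, q, m, m', a, a'; split=> //.
have E (a1 a2 a3 a4 : G) : (a1 - a2 = a3 - a4 -> a2 - a4 = a1 - a3)%R.
  by move=> /eqP; rewrite subr_eq => /eqP->; rewrite (addrC _ (- a3)%R) !addrA addNr add0r addrC.
rewrite (E _ _ _ _ (e p0 j0)) (E _ _ _ _ (e' p0' j0')).
by rewrite opprB addrA subrK.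
Qed.

Lemma coord_over (U V : subobject X) (m : hom (sub_ob U) (sub_ob V)) :
  incl V ∘ m ≈ incl U ->
  coord V ∘ (m : hom (sval (sub_ob U) : W) (sval (sub_ob V))) ≈ coord U.
Proof. by move=> e; rewrite /coord -comp_assoc; apply: comp_heq => //; exact: e. Qed.

Lemma dimension_of_iso (U V : subobject X) x y : subobject_iso U V ->
  dimension_of U x -> dimension_of V y -> x = y.
Proof.
move=> [m [[m' [m'm mm']] mU]] hx hy.
have m'V : incl U ∘ m' ≈ incl V by rewrite -mU -comp_assoc mm'; exact: comp_idr.
have [j [p [n [n' [i [i' [hi hi' lat lat' e]]]]]]] := dimension_common hx hy.
have [s es] := lattice_le (coord_over mU) hi hi' lat lat'.
have [s' es'] := lattice_le (coord_over m'V) hi' hi lat' lat.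
have nn' : isomorphic n n'.
  exists s, s'; split.
    by apply: (adm_mono_monic hi); rewrite comp_assoc es' es comp_idr.
  by apply: (adm_mono_monic hi'); rewrite comp_assoc es es' comp_idr.
by move/eqP: e; rewrite (dimension_iso hchi nn') subrr subr_eq0 => /eqP.
Qed.

Lemma dimension_step (U V : subobject X) (m : hom (sub_ob U) (sub_ob V)) (Q : beilinson A)
    (q : hom (sub_ob V) Q) (a : A) x y :
  incl V ∘ m ≈ incl U -> conflation m q -> isomorphic (sval Q) (inda_of_base a) ->
  dimension_of U x -> dimension_of V y -> y = (x + chi a)%R.
Proof.
move=> mU mq Qa hx hy.
have [j [p [n [n' [i [i' [hi hi' lat lat' e]]]]]]] := dimension_common hx hy.
have [s es] := lattice_le (coord_over mU) hi hi' lat lat'.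
have [b [c sc]] := AIC_cancel hA hi hi' es.
have [r mr] := lattice_conflation (coord_over mU) hi' lat lat' es sc.
have Qb : isomorphic (sval Q) (inda_of_base b).
  apply: (cokernel_unique (iso_idm _) (iso_idm _) _
    (@ind_exact A (sval (sub_ob U)) (sval (sub_ob V)) (sval Q) m q mq) (ind_exact mr)).
  by rewrite comp_idl; symmetry; exact: comp_idr.
have ab : isomorphic a b.
  apply: const_proa_isomorphic; apply: inda_of_proa_isomorphic.
  exact: isomorphic_trans (isomorphic_sym Qa) Qb.
rewrite (dimension_iso hchi ab); apply/eqP; rewrite addrC -subr_eq e.
by rewrite (hchi sc) addrC addKr.
Qed.

Lemma subobject_iso_refl (U : subobject X) : subobject_iso U U.
Proof. by exists (idm _); split; [exact: iso_idm|exact: comp_idr]. Qed.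

Lemma dimension_of_class (u : Gamma X) :
  exists x, exists U, sval u = @subobject_iso A X U /\ dimension_of U x.
Proof. by case: u => P [U e]; have [x hx] := dimension_exists U; exists x, U. Qed.

Definition dimension (u : Gamma X) : G := projT1 (cid (dimension_of_class u)).

Lemma dimensionE (U : subobject X) x :
  dimension_of U x -> dimension (class _ U) = x.
Proof.
move=> hx; rewrite /dimension; case: cid => y [V [/= e hy]] /=.
apply: dimension_of_iso hy hx; rewrite -e; exact: subobject_iso_refl.
Qed.

Lemma dimension_relative : relative_dimensional_theory chi dimension.
Proof.
move=> U V m mU Q q mq a Qa; have [x hx] := dimension_exists U.
have [y hy] := dimension_exists V.
by rewrite (dimensionE hx) (dimensionE hy); apply: dimension_step Qa hx hy; eassumption.
Qed.

Lemma row_sub_quotient (j : int) : exists (Q : beilinson A)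
    (q : hom X Q), @conflation (beilinson A)
      (exist _ (inda_of_proa (row D j)) (row_beilinson D j)) X Q (eps' ∘ row_incl D j) q /\
    in_inda Q.
Proof.
have [E [hE [rho c]]] := row_incl_conflation D j.
exists (exist _ (inda_of_inda (mk_proa hE : inda A)) (inda_of_inda_beilinson hE)), (rho ∘ eps).
split; last by exists (mk_proa hE); exists (idm _); exact: iso_idm.
apply: ind_conflation_iso c; exists (idm _), eps', (idm _); split=> //.
- exact: iso_idm.
- exact: iso_idm.
- by symmetry; exact: comp_idr.
by rewrite -comp_assoc eps_inv.2 comp_idl comp_idr.
Qed.

Definition row_subobject (j : int) : subobject X :=
  @Subobject A X (exist _ (inda_of_proa (row D j)) (row_beilinson D j))
    (eps' ∘ row_incl D j)
    (ex_intro _ (row D j) (ex_intro _ (idm _) (iso_idm _)))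
    (row_sub_quotient j).

Lemma coord_row (j : int) : coord (row_subobject j) ≈ row_incl D j.
Proof. by rewrite /coord comp_assoc eps_inv.2 comp_idl. Qed.

Lemma row_subobject_lattice (j : int) (p : row_index j) :
  lattice_at (coord (row_subobject j)) (idm (D (val p))).
Proof.
apply: (lattice_iso (iso_idm _) _ (lattice_row D p)).
by rewrite coord_row; exact: comp_idr.
Qed.

(** The quotient of the row [j] by [U] is [X_(i,j)/n]. *)
Lemma row_subobject_step (U : subobject X) (j : int) (p : row_index j) n
    (i : hom n (D (val p))) : adm_mono i -> lattice_at (coord U) i ->
  exists a : A, forall d : Dim chi X,
    sval d (class _ (row_subobject j)) = (sval d (class _ U) + chi a)%R.
Proof.
move=> hi lat; have [Y [w [f [g [[w' [w'w ww']] ew _]]]]] := lat.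
pose V := row_subobject j.
pose m : hom (sub_ob U) (sub_ob V) := ind_map f ∘ w'.
have mU : coord V ∘ (m : hom (sval (sub_ob U) : W) (sval (sub_ob V))) ≈ coord U.
  by rewrite coord_row /m comp_assoc -ew -comp_assoc ww' comp_idr.
have [a [c ic]] := hi.
have hid : adm_mono (idm (D (val p))).
  have [z hz] := has_zero_object (exact_additive (exact_axioms A)).
  have [[h _] _] := hz (D (val p)); exists z, h; exact: conflation_id_zero.
have [r mr] := lattice_conflation mU hid lat (row_subobject_lattice p)
  (comp_idl i) ic.
exists a => d.
apply: (svalP d U V m _ (exist _ (inda_of_base a) (inda_of_base_beilinson a)) r mr).
  by apply: (iso_monic eps_iso); rewrite comp_assoc.
by exists (idm _); exact: iso_idm.
Qed.

(** [U] and the row 0 both lie in the row max(j, 0), with quotients in the base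
    category. *)
Lemma relative_dimensions_differ_by_constant (d d' : Dim chi X) (U : subobject X) :
  (sval d' (class _ U) - sval d (class _ U) =
   sval d' (class _ (row_subobject 0)) - sval d (class _ (row_subobject 0)))%R.
Proof.
have [j [p [n [i [hi lat]]]]] := subobject_lattice U.
pose J := Order.max j 0%R.
have jJ : (j <= J)%R by rewrite le_max lexx.
have oJ : (0 <= J)%R by rewrite le_max lexx orbT.
pose o : row_index 0%R := exist _ (zdiag 0%R) (eqxx _).
have hiJ : adm_mono (dmap D (raise_ge jJ p) ∘ i).
  by apply: adm_mono_comp => //; [exact: exact_axioms|exact: dmap_mono].
have hoJ : adm_mono (dmap D (raise_ge oJ o) ∘ idm (D (val o))).
  apply: (adm_mono_iso (iso_idm _) (iso_idm _)) (dmap_mono D (raise_ge oJ o) erefl).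
  by rewrite !comp_idr comp_idl.
have [a ea] := row_subobject_step hiJ (lattice_raise jJ lat).
have [b eb] := row_subobject_step hoJ (lattice_raise oJ (row_subobject_lattice o)).
have E (x y z : G) : x = (y + z)%R -> y = (x - z)%R by move=> ->; rewrite addrK.
rewrite (E _ _ _ (ea d)) (E _ _ _ (ea d')) (E _ _ _ (eb d)) (E _ _ _ (eb d')).
by rewrite !opprB !addrA !subrK.
Qed.

Lemma dim_ext (d d' : Dim chi X) : (forall u, sval d u = sval d' u) -> d = d'.
Proof.
case: d d' => [d hd] [d' hd'] /= /funext e; rewrite e in hd *.
by congr exist; apply: Prop_irrelevance.
Qed.

Lemma class_surjective (u : Gamma X) : exists U, u = class (@subobject_iso A X) U.
Proof. 
case: u => P h; have [U e] := h; exists U; case: _ / (esym e) h => h.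
by congr exist; apply: Prop_irrelevance.
Qed.

Lemma relative_dimensions_torsor : is_torsor (@dim_act A G chi X).
Proof.
split.
- split=> [d|g h d]; apply: dim_ext => u /=; first by rewrite add0r.
  by rewrite addrA.
- move=> g d e; have := congr1 (fun d => sval d (class _ (row_subobject 0))) e.
  by move=> /= /eqP; rewrite -subr_eq0 addrK => /eqP.
- move=> d d'; exists (sval d' (class _ (row_subobject 0)) - sval d (class _ (row_subobject 0)))%R.
  apply: dim_ext => u; have [U ->] := class_surjective u.
  by rewrite /= -(relative_dimensions_differ_by_constant d d' U) subrK.
by exists (exist _ _ dimension_relative).
Qed.

End RelativeDimension.

Theorem proposition4p4 (A : exact_category) (hA : AIC A) (G : zmodType)
    (chi : A -> G) (hchi : dimensional_theory chi) (X : beilinson A) :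
  is_torsor (@dim_act A G chi X).
Proof.
have [D [eps [eps' h]]] := svalP X.
exact: (relative_dimensions_torsor hA hchi h).
Qed.
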